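(* Let $n\geq2$, $p,q>1$ and $c>0$ be real, and set $$\Gamma_{GG}(p,q,n):=\max\Big\{\frac{p+1}{pq-1},\frac{q+1}{pq-1}\Big\}-\frac{n-1}{2},\qquad \Gamma_{GG}^{*}(p,q,n):=\max\Big\{\frac{p}{pq-1},\frac{q}{pq-1}\Big\}-\frac{n-1}{2}.$$ Assume $$\Gamma_{GG}^{*}(p,q,n)>0\ \text{ if } c\neq1,\qquad \Gamma_{GG}(p,q,n)>0\ \text{ if } c=1.$$ Let $(\mathbb{R}^n,\mathfrak{g})$ be an asymptotically Euclidean manifold (as defined in the context), and consider the Cauchy problem $$\begin{cases}\partial_t^2u-c^2\Delta_{\mathfrak{g}}u=|v_t|^p, & (t,x)\in(0,T)\times\mathbb{R}^n,\\ \partial_t^2v-\Delta_{\mathfrak{g}}v=|u_t|^q, & (t,x)\in(0,T)\times\mathbb{R}^n,\\ u(0,x)=\varepsilon u_0(x),\quad u_t(0,x)=\varepsilon u_1(x),\\ v(0,x)=\varepsilon v_0(x),\quad v_t(0,x)=\varepsilon v_1(x),\end{cases}$$ where $u_0,u_1,v_0,v_1\in C_c^\infty(\mathbb{R}^n)$, both $(u_0,u_1)$ and $(v_0,v_1)$ are nontrivial, nonnegative and supported in $B_R=\{x\in\mathbb{R}^n:|x|\le R\}$ for some $R>0$, and the data satisfy $$\int_{\mathbb{R}^n}(u_1-c\lambda u_0)\phi_\lambda\,dv_{\mathfrak{g}}>0,\qquad \int_{\mathbb{R}^n}(v_1-\lambda v_0)\phi_\lambda\,dv_{\mathfrak{g}}>0.$$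 Suppose the problem has a weak solution $u,v\in C^2([0,T_\varepsilon);\mathcal{D}'(\mathbb{R}^n))$ with $|v_t|^p,|u_t|^q\in C([0,T_\varepsilon);\mathcal{D}'(\mathbb{R}^n))$ and with $$\operatorname{supp}u\subset D_1:=\Big\{(t,x):\int_0^{|x|}K(\tau)\,d\tau\le ct+R_1\Big\},\qquad \operatorname{supp}v\subset D_2:=\Big\{(t,x):\int_0^{|x|}K(\tau)\,d\tau\le t+R_1\Big\}.$$ Then there exists a constant $\varepsilon_0>0$ such that for any $\varepsilon\in(0,\varepsilon_0)$ the solution blows up at finite time. Moreover, there is a constant $C>0$ independent of $\varepsilon\in(0,\varepsilon_0)$ such that the lifespan satisfies $$T_\varepsilon\le\begin{cases}C\,\varepsilon^{-\Gamma_{GG}(q,p,n)^{-1}}, & c=1,\\ C\,\varepsilon^{-\Gamma_{GG}^{*}(p,q,n)^{-1}}, & c\neq1.\end{cases}$$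
   Context: Notation: $\langle r\rangle=\sqrt{1+r^2}$; $A\lesssim B$ means $A\le CB$ for some constant $C>0$; repeated indices are summed. Asymptotically Euclidean manifold: a Riemannian metric $\mathfrak{g}=g_{jk}(x)dx^jdx^k$ on $\mathbb{R}^n$ that decomposes as $\mathfrak{g}=\mathfrak{g}_1+\mathfrak{g}_2$, where: (i) in polar coordinates $x=r\omega$, $\mathfrak{g}_1=K^2(r)dr^2+r^2d\omega^2$, with $d\omega^2$ the standard metric on $\mathbb{S}^{n-1}$, and for some constant $\rho>0$, $|\partial_r^m(K-1)|\lesssim\langle r\rangle^{-m-\rho}$ for $m=0,1,2$; (ii) $\mathfrak{g}_2=g_{2,jk}(x)dx^jdx^k$ and for some $\beta>0$, $|\nabla g_{2,jk}|+|g_{2,jk}|\lesssim e^{-\beta\int_0^rK(\tau)d\tau}$ and $|\nabla^2g_{2,jk}|\lesssim1$ (with $r=|x|$); (iii) there is $\delta_0\in(0,1)$ with $\delta_0|\xi|^2\le g^{jk}\xi_j\xi_k\le\delta_0^{-1}|\xi|^2$ for all $\xi\in\mathbb{R}^n$, and $K\in(\delta_0,1/\delta_0)$, where $(g^{jk})$ is the inverse of $(g_{jk})$. $\Delta_{\mathfrak{g}}$ is the Laplace–Beltrami operator and $dv_{\mathfrak{g}}$ the Riemannian volume measure of $\mathfrak{g}$. The function $\phi_\lambda$: it is known (from earlier work) that there are $\lambda_0,c_0>0$ such that for every $0<\lambda\le\lambda_0$ there is a solution $\phi_\lambda$ on $\mathbb{R}^n$ of $\Delta_{\mathfrak{g}}\phi_\lambda=\lambda^2\phi_\lambda$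 with $c_0<\phi_\lambda(x)<c_0^{-1}\langle\lambda r\rangle^{-\frac{n-1}{2}}e^{\lambda\int_0^rK(\tau)d\tau}$, $r=|x|$. Here $\lambda\in(0,\lambda_0]$ and such a $\phi_\lambda$ are fixed. $R_1$ is a fixed constant, independent of $\varepsilon$, with $R_1\ge\int_0^{R}K(\tau)d\tau$. Weak solution means that the equations hold in the sense of distributions and the initial conditions are attained; $T_\varepsilon$ denotes the lifespan of the solution. *)

(* Defs.v *)
From HB Require Import structures.
From mathcomp Require Import all_boot all_order all_algebra.
From mathcomp Require Import all_classical all_reals all_analysis.

Set Implicit Arguments.
Unset Strict Implicit.
Unset Printing Implicit Defensive.

Import Order.TTheory GRing.Theory Num.Theory numFieldNormedType.Exports.

Local Open Scope classical_set_scope.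
Local Open Scope ring_scope.

(* The library has no n-dimensional Lebesgue measure: it is built here on
   n.-tuple R (product sigma-algebra) as the iterated product of the
   one-dimensional one. *)
Section lebesgue_tuple.
Context (R : realType).
Local Notation mR := (measurableTypeR R).

Definition tcons n (z : mR * n.-tuple mR) : n.+1.-tuple mR :=
  [tuple of z.1 :: z.2].

Lemma measurable_tcons n : measurable_fun [set: mR * n.-tuple mR] (@tcons n).
Proof. exact: measurable_cons. Qed.

Definition lebesgue_cons n (m : {sigma_finite_measure set (n.-tuple mR) -> \bar R}) :=
  pushforward (lebesgue_measure \x m)%E (@tcons n).

Section lebesgue_cons_measure.
Context n (m : {sigma_finite_measure set (n.-tuple mR) -> \bar R}).

Let mu : {measure set (n.+1.-tuple mR) -> \bar R} :=
  measure_function_pushforward__canonical__measure_function_Measure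
    (lebesgue_measure \x m)%E (@measurable_tcons n).

Let mu0 : lebesgue_cons m set0 = 0%E.
Proof. exact: (measure0 mu). Qed.

Let mu_ge0 A : (0 <= lebesgue_cons m A)%E.
Proof. exact: (measure_ge0 mu). Qed.

Let mu_semi_sigma_additive : semi_sigma_additive (lebesgue_cons m).
Proof. exact: (@measure_semi_sigma_additive _ _ _ mu). Qed.

HB.instance Definition _ := isMeasure.Build _ _ _
  (lebesgue_cons m) mu0 mu_ge0 mu_semi_sigma_additive.

Let mu_sigma_finite : sigma_finite setT (lebesgue_cons m).
Proof.
have /sigma_finiteP[F [TF ndF Foo]] := sigma_finiteT (@lebesgue_measure R).
have /sigma_finiteP[G [TG ndG Goo]] := sigma_finiteT m.
have mth : measurable_fun setT (fun x : n.+1.-tuple mR => thead x : mR).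
  exact: (measurable_tnth ord0).
have mtl : measurable_fun setT
    (fun x : n.+1.-tuple mR => [tuple of behead x] : n.-tuple mR).
  exact: measurable_behead.
pose h (x : n.+1.-tuple mR) : n.-tuple mR := [tuple of behead x].
exists (fun k => (fun x => thead x) @^-1` F k `&` h @^-1` G k).
  rewrite predeqE => x; split=> // _.
  have [i _ Fi] : (\bigcup_i F i) (thead x) by rewrite -TF.
  have [j _ Gj] : (\bigcup_i G i) (h x) by rewrite -TG.
  exists (maxn i j) => //; split.
  - by have /subsetPset := ndF _ _ (leq_maxl i j); apply.
  - by have /subsetPset := ndG _ _ (leq_maxr i j); apply.
move=> k; have [mF Fk] := Foo k; have [mG Gk] := Goo k; split.
  apply: measurableI; rewrite -[X in measurable X]setTI; first exact: mth.
  exact: mtl.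
rewrite /lebesgue_cons /pushforward (_ : _ @^-1` _ = F k `*` G k).
  by rewrite product_measure1E// lte_mul_pinfty// ge0_fin_numE.
apply/seteqP; split=> -[a t] /=; rewrite /h /tcons /= theadE;
  by rewrite (_ : [tuple of _] = t) //; apply/val_inj.
Qed.

HB.instance Definition _ := Measure_isSigmaFinite.Build _ _ _
  (lebesgue_cons m) mu_sigma_finite.

End lebesgue_cons_measure.

Fixpoint lebesgue_tuple n : {sigma_finite_measure set (n.-tuple mR) -> \bar R} :=
  match n with
  | 0%N => dirac [tuple]
  | n'.+1 => lebesgue_cons (lebesgue_tuple n')
  end.
End lebesgue_tuple.

Section euclidean_space.
Context (R : realType) (n : nat).
Implicit Types (f h psi : 'rV[R]_n -> R) (x y : 'rV[R]_n).

Definition rV_of (t : n.-tuple (measurableTypeR R)) : 'rV[R]_n :=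
  \row_i tnth t i.

(* The library norm on 'rV[R]_n is the sup norm; this is the Euclidean one. *)
Definition enorm x : R := Num.sqrt (\sum_i x 0 i ^+ 2).

Definition japanese (r : R) : R := Num.sqrt (1 + r ^+ 2).

Definition pd (i : 'I_n) f : 'rV[R]_n -> R := fun x => 'D_(delta_mx 0 i) f x.

Definition pderiv (s : seq 'I_n) f : 'rV[R]_n -> R := foldr pd f s.

Definition gradient f x : 'rV[R]_n := \row_i pd i f x.

(* C^oo: partial derivatives of every order exist and are continuous. *)
Definition smooth f : Prop :=
  forall s : seq 'I_n, continuous (pderiv s f) /\
    forall (i : 'I_n) x, derivable (pderiv s f) x (delta_mx 0 i).

Definition tsupp f : set 'rV[R]_n := closure [set x | f x != 0].

(* C_c^oo(R^n) *)
Definition test_function f : Prop := smooth f /\ compact (tsupp f).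

(* L^1_loc(R^n) *)
Definition loc_integrable f : Prop :=
  forall A : set 'rV[R]_n, compact A ->
    (lebesgue_tuple R n).-integrable (rV_of @^-1` A)
      (fun t => (f (rV_of t))%:E).

End euclidean_space.

Section riemannian_metric.
Context (R : realType) (n : nat).
Implicit Types (g : 'rV[R]_n -> 'M[R]_n) (K : R -> R) (f : 'rV[R]_n -> R).

Definition riemannian_metric g : Prop :=
  (forall j k, smooth (fun x => g x j k)) /\
  (forall x, (g x)^T = g x /\
     forall xi : 'rV[R]_n, xi != 0 -> 0 < (xi *m g x *m xi^T) 0 0).

Definition vol_density g (x : 'rV[R]_n) : R := Num.sqrt (\det (g x)).

(* integral over R^n against the Riemannian volume dv_g = sqrt(det g) dx *)
Definition vint g f : R :=
  \int[lebesgue_tuple R n]_t (f (rV_of t) * vol_density g (rV_of t)).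

Definition laplace_beltrami g f : 'rV[R]_n -> R := fun x =>
  (vol_density g x)^-1 *
  \sum_j pd j (fun y =>
    vol_density g y * \sum_k (invmx (g y) j k * pd k f y)) x.

Definition radial K (r : R) : R := \int[lebesgue_measure]_(s in `[0, r]) K s.

(* K^2 dr^2 + r^2 dw^2 = |dx|^2 + (K^2 - 1) dr^2 in Cartesian coordinates;
   dr = sum_j (x_j / r) dx^j, for x <> 0. *)
Definition radial_metric K (x : 'rV[R]_n) : 'M[R]_n :=
  \matrix_(j, k) ((j == k)%:R +
    (K (enorm x) ^+ 2 - 1) * (x 0 j / enorm x) * (x 0 k / enorm x)).

(* Polar coordinates only make sense off the origin, so the decomposition
   and the bounds on K and g2 are required for r > 0 only. *)
Definition asymptotically_euclidean g K : Prop :=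
  riemannian_metric g /\
  exists g2 : 'rV[R]_n -> 'M[R]_n,
  [/\ forall x : 'rV[R]_n, x != 0 -> g x = radial_metric K x + g2 x,
      (forall r : R, 0 < r -> derivable K r 1 /\ derivable (derive1 K) r 1) /\
      (exists rho C : R, [/\ 0 < rho, 0 < C &
         forall (m : nat) (r : R), (m <= 2)%N -> 0 < r ->
           `|derive1n m (fun s => K s - 1) r| <= C * japanese r `^ (- m%:R - rho)]),
      (forall (x : 'rV[R]_n) (j k : 'I_n), x != 0 -> forall i : 'I_n,
         derivable (fun y => g2 y j k) x (delta_mx 0 i) /\
         forall l : 'I_n, derivable (pd i (fun y => g2 y j k)) x (delta_mx 0 l)) /\
      (exists beta C : R, [/\ 0 < beta, 0 < C &
         forall (x : 'rV[R]_n) (j k : 'I_n), x != 0 ->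
           enorm (gradient (fun y => g2 y j k) x) + `|g2 x j k|
             <= C * expR (- beta * radial K (enorm x)) /\
           forall i l : 'I_n, `|pd l (pd i (fun y => g2 y j k)) x| <= C]) &
      exists delta0 : R, [/\ 0 < delta0 < 1,
        forall x (xi : 'rV[R]_n),
          delta0 * enorm xi ^+ 2 <= (xi *m invmx (g x) *m xi^T) 0 0
            <= delta0^-1 * enorm xi ^+ 2 &
        forall r : R, 0 < r -> delta0 < K r < delta0^-1]].

Definition phi_lambda g K (lambda c0 : R) (phi : 'rV[R]_n -> R) : Prop :=
  [/\ smooth phi,
      forall x, laplace_beltrami g phi x = lambda ^+ 2 * phi x &
      forall x, c0 < phi x <
        c0^-1 * japanese (lambda * enorm x) `^ (- ((n%:R - 1) / 2))
          * expR (lambda * radial K (enorm x))].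

End riemannian_metric.

Section distributions.
Context (R : realType) (n : nat).

(* A distribution is a functional used on test functions only; a locally
   integrable f is identified with psi |-> \int f psi dv_g. *)
Definition functional := ('rV[R]_n -> R) -> R.

Definition is_distribution (D : functional) : Prop :=
  (forall (a : R) psi1 psi2, test_function psi1 -> test_function psi2 ->
     D (fun x => a * psi1 x + psi2 x) = a * D psi1 + D psi2) /\
  (forall A : set 'rV[R]_n, compact A -> exists (N : nat) (C : R),
     forall psi (M : R), test_function psi -> tsupp psi `<=` A ->
       (forall s x, (size s <= N)%N -> `|pderiv s psi x| <= M) ->
       `|D psi| <= C * M).

Definition distr_of_fun (g : 'rV[R]_n -> 'M[R]_n) (f : 'rV[R]_n -> R) :
  functional := fun psi => vint g (fun x => f x * psi x).

Definition distr_eq (D E : functional) : Prop :=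
  forall psi, test_function psi -> D psi = E psi.

(* Delta_g is symmetric with respect to dv_g. *)
Definition distr_laplace (g : 'rV[R]_n -> 'M[R]_n) (D : functional) :
  functional := fun psi => D (laplace_beltrami g psi).

Definition times (T : \bar R) : set R := [set t | 0 <= t /\ (t%:E < T)%E].

(* C([0, T); D'(R^n)) for the weak topology of D'(R^n) *)
Definition C0_distr (T : \bar R) (u : R -> functional) : Prop :=
  (forall t, times T t -> is_distribution (u t)) /\
  (forall psi, test_function psi ->
     {within times T, continuous (fun t => u t psi)}).

(* ut is the derivative of u on [0, T), one-sided at t = 0. *)
Definition deriv_distr (T : \bar R) (u ut : R -> functional) : Prop :=
  forall psi, test_function psi -> forall t, times T t ->
    (fun s => (u s psi - u t psi) / (s - t)) @ within (times T) t^'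
      --> ut t psi.

Definition C2_distr (T : \bar R) (u ut utt : R -> functional) : Prop :=
  [/\ C0_distr T u, C0_distr T ut, C0_distr T utt,
      deriv_distr T u ut & deriv_distr T ut utt].

(* (t, x) is outside the support of u iff u vanishes on a relatively open
   neighbourhood of (t, x) in [0, T) x R^n. *)
Definition distr_supp (T : \bar R) (u : R -> functional) :
  set (R * 'rV[R]_n) :=
  [set z | times T z.1 /\
     ~ exists d : R, 0 < d /\
         forall s psi, times T s -> `|s - z.1| < d -> test_function psi ->
           tsupp psi `<=` [set y | enorm (y - z.2) < d] -> u s psi = 0].

End distributions.

Section wave_system.
Context (R : realType) (n : nat) (g : 'rV[R]_n -> 'M[R]_n) (K : R -> R).

(* w represents the time derivative ut of u by functions, which is what gives
   a meaning to |u_t|^q, and |w|^q is in C([0, T); D'(R^n)). *)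
Definition power_term (T : \bar R) (q : R) (ut : R -> functional R n)
    (w : R -> 'rV[R]_n -> R) : Prop :=
  [/\ forall t, times T t -> loc_integrable (w t) /\
        distr_eq (ut t) (distr_of_fun g (w t)),
      forall t, times T t -> loc_integrable (fun x => `|w t x| `^ q) &
      C0_distr T (fun t => distr_of_fun g (fun x => `|w t x| `^ q))].

(* The equation holds in D'(R^n) at every time t in (0, T): both sides are
   continuous curves in D'(R^n), so this is the equality of distributions on
   (0, T) x R^n. *)
Definition wave_problem (T : \bar R) (a eps : R) (f0 f1 : 'rV[R]_n -> R)
    (F : R -> 'rV[R]_n -> R) (u ut utt : R -> functional R n) : Prop :=
  [/\ forall t, 0 < t -> (t%:E < T)%E ->
        distr_eq (fun psi => utt t psi - a ^+ 2 * distr_laplace g (u t) psi)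
                 (distr_of_fun g (F t)),
      distr_eq (u 0) (distr_of_fun g (fun x => eps * f0 x)) &
      distr_eq (ut 0) (distr_of_fun g (fun x => eps * f1 x))].

Definition cone (a R1 : R) : set (R * 'rV[R]_n) :=
  [set z | radial K (enorm z.2) <= a * z.1 + R1].

Definition weak_solution (c p q R1 : R) (u0 u1 v0 v1 : 'rV[R]_n -> R)
    (eps : R) (T : \bar R) (u v : R -> functional R n) : Prop :=
  (0 < T)%E /\
  exists ut utt vt vtt : R -> functional R n,
  exists wu wv : R -> 'rV[R]_n -> R,
  [/\ C2_distr T u ut utt /\ C2_distr T v vt vtt,
      power_term T q ut wu /\ power_term T p vt wv,
      wave_problem T c eps u0 u1 (fun t x => `|wv t x| `^ p) u ut utt,
      wave_problem T 1 eps v0 v1 (fun t x => `|wu t x| `^ q) v vt vtt &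
      distr_supp T u `<=` cone c R1 /\ distr_supp T v `<=` cone 1 R1].

(* The supremum of the times up to which the solution (u, v) on [0, T)
   extends as a weak solution. *)
Definition lifespan (c p q R1 : R) (u0 u1 v0 v1 : 'rV[R]_n -> R) (eps : R)
    (T : \bar R) (u v : R -> functional R n) : \bar R :=
  ereal_sup [set T' | (T <= T')%E /\
    exists u' v' : R -> functional R n,
      weak_solution c p q R1 u0 u1 v0 v1 eps T' u' v' /\
      forall t, times T t -> distr_eq (u' t) (u t) /\ distr_eq (v' t) (v t)].

End wave_system.

Section exponents.
Context (R : realType).

Definition GammaGG (p q : R) (n : nat) : R :=
  Num.max ((p + 1) / (p * q - 1)) ((q + 1) / (p * q - 1)) - (n%:R - 1) / 2.

Definition GammaGGstar (p q : R) (n : nat) : R :=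
  Num.max (p / (p * q - 1)) (q / (p * q - 1)) - (n%:R - 1) / 2.

End exponents.

(* Main.v *)
Require Import Defs.
From HB Require Import structures.
From mathcomp Require Import all_boot all_order all_algebra.
From mathcomp Require Import all_classical all_reals all_analysis.
From mathcomp Require Import perm measurable_realfun ring lra.

Set Implicit Arguments.
Unset Strict Implicit.
Unset Printing Implicit Defensive.

Import Order.TTheory GRing.Theory Num.Theory numFieldNormedType.Exports.

Local Open Scope classical_set_scope.
Local Open Scope ring_scope.

(** Pairing the unknowns with the eigenfunction [phi] reduces the system to two
    coupled ordinary differential inequalities. Since [Delta phi = lambda^2 phi],
    the pairings [G = <u, phi>] and [H = <v, phi>] satisfy
    [G'' - (c lambda)^2 G = int |v_t|^p phi] and
    [H'' - lambda^2 H = int |u_t|^q phi]. The condition on the data says that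
    [G' - c lambda G] is positive at time 0; it stays so because the source is
    nonnegative, and therefore [G'] dominates [exp (c lambda t) x], where
    [x = exp (- c lambda t) (G' + c lambda G) / 2] is nondecreasing with derivative
    [exp (- c lambda t) int |v_t|^p phi / 2] ([second_order_growth]). The same holds
    for [H], with a function [y].

    The support hypothesis closes the system. At time [t] the function [v_t] lives
    in a ball whose radius, measured by the integral of [K], is [t] up to a
    constant, so Jensen's inequality bounds
    [int |v_t|^p phi] below by [(H')^p] divided by the [p - 1]st power of the mass
    of [phi] on that ball ([vint_jensen]). This mass is at most of order
    [(1 + t)^m exp (lambda t)] with [m = (n - 1) / 2] ([phi_mass]): the exponential
    growth of [phi] concentrates it in a boundary layer of bounded width, whose
    volume is of order [(1 + t)^(n - 1)], and [phi] carries a factor [(1 + t)^(- m)]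
    there. The result is the pair of inequalities named [feedback], in which the
    two exponentials leave a factor [exp (-+ (c - 1) lambda t)].

    For [c = 1] the exponentials cancel. The time that [x] needs to double is a
    negative power of [x], so the successive doubling times are summable and [x]
    becomes infinite ([coupled_blowup]); keeping track of the weights gives
    [T^((p + 1) / (p q - 1)) <= C T^m / eps], or the same with [p] and [q]
    exchanged, whichever is better. For [c <> 1] one inequality gains an
    exponential that the other loses; inserting one into the other raises the gain
    to a power larger than 1, so over a time interval of unit length
    [exp (k t)], with [k > 0], beats every power of [t], and [T] is bounded by any
    negative power of [eps], in particular by the one claimed
    ([nonresonant_lifespan]).

    What remains is to give a meaning to [<u, phi>], since [phi] is not compactly
    supported. It is replaced by a truncation far outside the cone. A distribution
    that vanishes near every point off the cone vanishes on every test function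
    supported off the cone ([vanish_off_support]), so the truncation changes none
    of the pairings; for the same reason [phi] may be cut off close to the cone in
    Jensen's inequality. All the constants are independent of the solution and of
    its existence time, so the bound holds for every weak solution extending the
    given one, hence for the lifespan. *)

(** * Coupled differential inequalities *)

Section blowup.
Context {R : realType}.
Implicit Types (x y dx dy f df : R -> R) (a b p q t k m eps e r kap B C G S T X z : R).

Lemma MVT_lower_bound f df a b m : a <= b ->
  (forall t, a < t < b -> is_derive t 1 f (df t)) ->
  {within `[a, b], continuous f} ->
  (forall t, a < t < b -> m <= df t) ->
  f a + m * (b - a) <= f b.
Proof.
rewrite le_eqVlt => /predU1P[-> _ _ _|ab fdf cf mdf].
  by rewrite subrr mulr0 addr0.
have [c cab fab] : exists2 c, c \in `]a, b[ & f b - f a = df c * (b - a).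
  by apply: MVT => // t; rewrite in_itv/=; exact: fdf.
rewrite -lerBrDl fab ler_wpM2r ?subr_ge0 ?(ltW ab)// mdf//.
Qed.

Lemma powR_exprn a p (j : nat) : 0 <= a -> (a ^+ j) `^ p = (a `^ p) ^+ j.
Proof.
by move=> a0; rewrite -(powR_mulrn j a0) powRAC (powR_mulrn j (powR_ge0 _ _)).
Qed.

Section doubling.
Context (x dx y dy : R -> R) (t0 t1 p q al be : R).
Context (p0 : 0 < p) (q0 : 0 < q) (al0 : 0 < al) (be0 : 0 < be).
Context (xdx : forall t, t0 < t < t1 -> is_derive t 1 x (dx t))
  (ydy : forall t, t0 < t < t1 -> is_derive t 1 y (dy t))
  (cx : {within `[t0, t1], continuous x})
  (cy : {within `[t0, t1], continuous y})
  (dx_ge : forall t, t0 < t < t1 -> al * y t `^ p <= dx t)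
  (dy_ge : forall t, t0 < t < t1 -> be * x t `^ q <= dy t).
Context (y_ge0 : 0 <= y t0).

Let incr f df m a b :
  (forall t, t0 < t < t1 -> is_derive t 1 f (df t)) ->
  {within `[t0, t1], continuous f} ->
  t0 <= a -> a <= b -> b <= t1 ->
  (forall t, a < t < b -> m <= df t) ->
  f a + m * (b - a) <= f b.
Proof.
move=> fdf cf ta ab bt mdf; apply: (MVT_lower_bound ab (df := df)) => //.
  move=> t /andP[at_ tb]; apply: fdf; apply/andP; split; first exact: le_lt_trans at_.
  exact: lt_le_trans bt.
apply: continuous_subspaceW cf => z /=; rewrite !in_itv/= => /andP[az zb].
by rewrite (le_trans ta az) (le_trans zb bt).
Qed.

Let lift a b t : t0 <= a -> b <= t1 -> a < t < b -> t0 < t < t1.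
Proof.
by move=> ta bt /andP[at_ tb]; rewrite (le_lt_trans ta at_) (lt_le_trans tb bt).
Qed.

Let x_incr a b : t0 <= a -> a <= b -> b <= t1 -> x a <= x b.
Proof.
move=> ta ab bt; rewrite -[x a]addr0 -[in X in X <= _](mul0r (b - a)).
apply: (incr xdx) => // t tab; apply: le_trans (dx_ge (lift ta bt tab)).
by rewrite mulr_ge0 ?powR_ge0// ltW.
Qed.

Let y_incr a b : t0 <= a -> a <= b -> b <= t1 -> y a <= y b.
Proof.
move=> ta ab bt; rewrite -[y a]addr0 -[in X in X <= _](mul0r (b - a)).
apply: (incr ydy) => // t tab; apply: le_trans (dy_ge (lift ta bt tab)).
by rewrite mulr_ge0 ?powR_ge0// ltW.
Qed.

(** During a first time span [tau] the bound on [x] makes [y] grow; during a second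
    one this growth feeds back into [x]. *)
Lemma feedback_step t tau Z : t0 <= t -> 0 <= tau -> t + tau *+ 2 <= t1 ->
  0 <= Z -> Z <= x t ->
  Z + al * (be * Z `^ q * tau) `^ p * tau <= x (t + tau *+ 2).
Proof.
move=> tt tau0 tt1 Z0 Zx.
have tm : t + tau <= t1 by rewrite (le_trans _ tt1)// mulr2n addrA lerDl.
have ytau : be * Z `^ q * tau <= y (t + tau).
  apply: (@le_trans _ _ (y t + be * Z `^ q * (t + tau - t))).
    by rewrite (addrC t) addrK lerDr (le_trans y_ge0)// y_incr// (le_trans _ tm)// lerDl.
  apply: (incr ydy) => //; first by rewrite lerDl.
  move=> s tst; apply: le_trans (dy_ge (lift tt tm tst)).
  rewrite ler_pM2l// ge0_ler_powR ?nnegrE//; first exact: ltW.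
    rewrite (le_trans Z0)// (le_trans Zx)//; move/andP: tst => [ts st].
    by apply: x_incr => //; [exact: ltW|exact: le_trans (ltW st) tm].
  rewrite (le_trans Zx)//; move/andP: tst => [ts st].
  by apply: x_incr => //; [exact: ltW|exact: le_trans (ltW st) tm].
rewrite (@le_trans _ _ (x (t + tau) +
  al * (be * Z `^ q * tau) `^ p * (t + tau *+ 2 - (t + tau))))//.
  rewrite mulr2n addrA [X in _ * (X - _)]addrC addrK lerD2r (le_trans Zx)//.
  by apply: x_incr => //; rewrite lerDl.
apply: (incr xdx) => //; first by rewrite (le_trans tt)// lerDl.
  by rewrite mulr2n addrA lerDl.
move=> s tst; have ts : t0 <= t + tau by rewrite (le_trans tt)// lerDl.
apply: le_trans (dx_ge (lift ts tt1 tst)).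
move/andP: tst => [tsl tsr].
have yy : be * Z `^ q * tau <= y s.
  rewrite (le_trans ytau)// y_incr//; first exact: ltW.
  by rewrite (le_trans _ tt1)// ltW.
have b0 : 0 <= be * Z `^ q * tau by rewrite !mulr_ge0// ?powR_ge0// ltW.
rewrite ler_pM2l// ge0_ler_powR ?nnegrE//; first exact: ltW.
exact: le_trans yy.
Qed.

(** Doubling argument. When [x] is at least [Z], [feedback_step] doubles it within a
    time proportional to [Z^(- (p q - 1) / (p + 1))]. Along [Z = 2^j X0] these times
    form a geometric series, and a continuous function cannot stay defined beyond
    its sum. *)
Lemma coupled_blowup X0 : 1 < p * q -> t0 <= t1 -> 0 < X0 -> X0 <= x t0 ->
  (t1 - t0) `^ (p + 1) * (al * be `^ p * X0 `^ (p * q - 1)) <=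
  (2 / (1 - 2 `^ (- ((p * q - 1) / (p + 1))))) `^ (p + 1).
Proof.
move=> pq1 t01 X00 X0x.
set E := al * _ * _; set si := (p * q - 1) / (p + 1).
have p10 : 0 < p + 1 by rewrite addr_gt0.
have p1n0 : p + 1 != 0 by rewrite gt_eqF.
have si0 : 0 < si by rewrite divr_gt0// subr_gt0.
set th : R := 2 `^ (- si).
have th0 : 0 < th by rewrite powR_gt0.
have th1 : th < 1.
  rewrite /th powRN invf_lt1 ?powR_gt0//.
  have := gt0_ltr_powR si0; move=> /(_ 1 2).
  by rewrite !nnegrE ler01 ler0n ltr1n => /(_ isT isT isT); rewrite powR1.
have E0 : 0 < E by rewrite !mulr_gt0// powR_gt0.
(* [D] is half the time allotted to the first doubling. *)
set D := E `^ (- (p + 1)^-1).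
have D0 : 0 < D by rewrite powR_gt0.
have DE : D `^ (p + 1) * E = 1.
  by rewrite /D -powRrM mulNr mulVf// powR_inv1 ?ltW// mulVf// gt_eqF.
(* [s j] is the time by which [x] has doubled [j] times. *)
set s := fun j : nat => 2 * D * (1 - th ^+ j) / (1 - th).
have th1n0 : 1 - th != 0 by rewrite subr_eq0 gt_eqF.
have sS j : s j.+1 = s j + (D * th ^+ j) *+ 2.
  by rewrite /s exprS -mulr_natr; field.
set Cb := 2 / (1 - th).
have Cb0 : 0 < Cb by rewrite divr_gt0// subr_gt0.
have [short|long] := ltP (t1 - t0) (Cb * D).
  rewrite (@le_trans _ _ ((Cb * D) `^ (p + 1) * E))//.
    rewrite (ler_pM2r E0); apply: ge0_ler_powR; rewrite ?nnegrE ?subr_ge0.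
    - exact: ltW.
    - exact: t01.
    - exact: mulr_ge0 (ltW Cb0) (ltW D0).
    - exact: ltW short.
  by rewrite powRM ?(ltW Cb0) ?(ltW D0)// -mulrA DE mulr1.
exfalso.
have sle j : t0 + s j <= t1.
  rewrite addrC -lerBrDr (le_trans _ long)// /s /Cb.
  rewrite [leRHS]mulrAC ler_pM2r ?invr_gt0 ?subr_gt0//.
  by rewrite ler_piMr ?mulr_ge0 ?(ltW D0)// gerBl exprn_ge0// ltW.
have s_ge0 j : 0 <= s j.
  rewrite /s divr_ge0 ?subr_ge0 ?(ltW th1)// mulr_ge0 ?mulr_ge0 ?(ltW D0)//.
  by rewrite subr_ge0 exprn_ile1// ltW.
have grow j : X0 * 2 ^+ j <= x (t0 + s j).
  elim: j => [|j IH]; first by rewrite /s !expr0 subrr mulr0 mul0r addr0 mulr1.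
  set Z := X0 * 2 ^+ j.
  have Z0 : 0 < Z by rewrite mulr_gt0// exprn_gt0.
  have tau0 : 0 < D * th ^+ j by rewrite mulr_gt0// exprn_gt0.
  have := @feedback_step (t0 + s j) (D * th ^+ j) Z.
  rewrite lerDl s_ge0 (ltW tau0) -addrA -sS sle (ltW Z0) => /(_ isT isT isT isT IH).
  apply: le_trans; rewrite exprSr mulrA mulr_natr mulr2n -/Z lerD2l.
  set tau := D * th ^+ j in tau0 *.
  rewrite le_eqVlt; apply/orP; left; rewrite eq_sym; apply/eqP.
  have -> : al * (be * Z `^ q * tau) `^ p * tau =
      al * be `^ p * (Z `^ (p * q - 1) * Z) * (tau `^ (p + 1)).
    rewrite (@powRM _ (be * Z `^ q) tau p) ?(mulr_ge0 (ltW be0) (powR_ge0 _ _)) ?(ltW tau0)//.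
    rewrite (@powRM _ be (Z `^ q) p) ?powR_ge0 ?(ltW be0)//.
    have -> : Z `^ (p * q - 1) * Z = Z `^ (p * q).
      by rewrite mulrC mulr_powRB1 ?(ltW Z0)//; exact: lt_trans pq1.
    rewrite -powRrM (mulrC q p).
    rewrite powRD ?powRr1 ?(ltW tau0)//; last by rewrite gt_eqF// implybT.
    ring.
  have -> : Z `^ (p * q - 1) = X0 `^ (p * q - 1) * (2 `^ (p * q - 1)) ^+ j.
    rewrite powRM ?(ltW X00) ?exprn_ge0//; congr *%R.
    exact: powR_exprn.
  have -> : tau `^ (p + 1) = D `^ (p + 1) * (2 `^ (- (p * q - 1))) ^+ j.
    rewrite powRM ?(ltW D0) ?exprn_ge0 ?(ltW th0)//; congr *%R.
    have -> : 2 `^ (- (p * q - 1)) = th `^ (p + 1).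
      by rewrite /th -powRrM /si mulNr mulfVK.
    exact: powR_exprn (ltW th0).
  rewrite powRN exprVn.
  have nz : (2 : R) `^ (p * q - 1) != 0 by rewrite gt_eqF// powR_gt0.
  transitivity (D `^ (p + 1) * E * Z); last by rewrite DE mul1r.
  by rewrite /E; field; rewrite expf_neq0.
have [N xN] : exists N : nat, x t1 / X0 < N%:R.
  exists (Num.bound `|x t1 / X0|)%N.
  exact: le_lt_trans (ler_norm _) (archi_boundP (normr_ge0 _)).
have := grow N; apply/negP; rewrite -ltNge.
rewrite (@le_lt_trans _ _ (x t1))//.
  by apply: x_incr => //; rewrite lerDl.
rewrite mulrC -ltr_pdivrMr// (lt_trans xN)// -natrX ltr_nat ltn_expl//.
Qed.
End doubling.

(** The system obtained from the two wave equations: [kap] is the difference of the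
    exponential rates of the two components, [m] the power of time in the mass of
    the eigenfunction over the cone. *)
Definition feedback (kap k m p q T : R) (x dx y dy : R -> R) : Prop :=
  [/\ forall t, 0 < t < T -> is_derive t 1 x (dx t) /\ is_derive t 1 y (dy t),
      {within `[0, T], continuous x}, {within `[0, T], continuous y} &
      forall t, 0 < t < T ->
        k * expR (- kap * t) * (1 + t) `^ (- (m * (p - 1))) * y t `^ p <= dx t /\
        k * expR (kap * t) * (1 + t) `^ (- (m * (q - 1))) * x t `^ q <= dy t].

Lemma feedback_sym kap k m p q T x dx y dy :
  feedback kap k m p q T x dx y dy -> feedback (- kap) k m q p T y dy x dx.
Proof.
move=> [d cx cy h]; split=> // t tT; first by have [] := d t tT.
by rewrite opprK; have [] := h t tT.
Qed.

(** The form in which both lifespan estimates come out; [r] stands for [p q - 1]. *)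
Lemma solve_powR_le z e B C G r : 0 < z -> 0 < e -> 0 < B -> 0 < G -> 0 < r ->
  B * z `^ (G * r) * e `^ r <= C ->
  z <= (C / B) `^ (G * r)^-1 * e `^ (- G^-1).
Proof.
move=> z0 e0 B0 G0 r0 h.
have Gr0 : 0 < G * r by rewrite mulr_gt0.
have er0 : 0 < e `^ r by rewrite powR_gt0.
have h1 : z `^ (G * r) <= C / B * e `^ (- r).
  by rewrite powRN ler_pdivlMr// ler_pdivlMr// mulrC mulrA.
have CB0 : 0 <= C / B.
  have /(le_trans (powR_ge0 _ _)) := h1.
  by rewrite pmulr_lge0// powR_gt0.
have -> : z = (z `^ (G * r)) `^ (G * r)^-1.
  by rewrite -powRrM divff ?powRr1 ?(ltW z0)// gt_eqF.
have -> : e `^ (- G^-1) = (e `^ (- r)) `^ (G * r)^-1.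
  by rewrite -powRrM; congr (_ `^ _); field; rewrite !gt_eqF.
rewrite -(@powRM _ (C / B)) ?powR_ge0//.
apply: ge0_ler_powR; rewrite ?nnegrE ?powR_ge0//.
- by rewrite invr_ge0 ltW.
- by rewrite mulr_ge0// powR_ge0.
Qed.

Lemma powR_le_expR a m z : 0 < a -> 0 < m -> 0 <= z ->
  (a / m) `^ m * (1 + z) `^ m <= expR (a * (1 + z)).
Proof.
move=> a0 m0 z0; have z10 : 0 < 1 + z by rewrite ltr_wpDr.
rewrite -powRM ?(ltW z10) ?divr_ge0 ?(ltW a0) ?(ltW m0)//.
have -> : a * (1 + z) = (a / m * (1 + z)) * m by field; rewrite gt_eqF.
rewrite expRM; apply: ge0_ler_powR; rewrite ?nnegrE ?expR_ge0 ?(ltW m0)//.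
  by rewrite mulr_ge0 ?(ltW z10) ?divr_ge0 ?(ltW a0) ?(ltW m0).
by rewrite (le_trans _ (expR_ge1Dx _))// lerDr.
Qed.

Lemma powRN_le a b m : 0 <= m -> 0 < b -> b <= a -> a `^ (- m) <= b `^ (- m).
Proof.
move=> m0 b0 ba; have a0 : 0 < a by exact: lt_le_trans ba.
rewrite !powRN lef_pV2 ?posrE ?powR_gt0//.
by apply: ge0_ler_powR; rewrite ?nnegrE ?(ltW a0) ?(ltW b0).
Qed.

Lemma powRN_inv_ge1 e G : 0 < e < 1 -> 0 < G -> 1 <= e `^ (- G^-1).
Proof.
move=> /andP[e0 e1] G0; rewrite powRN -[leLHS]invr1 lef_pV2 ?posrE ?powR_gt0//.
have := @ge0_ler_powR _ G^-1 _ e 1; rewrite invr_ge0 (ltW G0) !nnegrE powR1.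
by apply => //; exact: ltW.
Qed.

Lemma weight_decreasing T t m p : 0 <= m -> 1 < p -> 0 < t < T ->
  (1 + T) `^ (- (m * (p - 1))) <= (1 + t) `^ (- (m * (p - 1))).
Proof.
move=> m0 p1 /andP[t0 tT].
have t10 : 0 < 1 + t by rewrite ltr_wpDl.
have T10 : 0 < 1 + T by rewrite ltr_wpDl// (lt_trans t0).
rewrite !powRN lef_pV2 ?posrE ?powR_gt0//.
apply: ge0_ler_powR; rewrite ?nnegrE ?(ltW t10) ?(ltW T10) ?lerD2l ?(ltW tT)//.
by rewrite mulr_ge0// subr_ge0 ltW.
Qed.

(** On the window [[S, T]] the weights are replaced by their infima, which reduces
    the system to the autonomous one. The exponents combine to
    [(p - 1) kap S - kap (T - S)]: for [kap > 0] a late and short window pays off. *)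
Lemma feedback_window kap k m p q T x dx y dy S X0 : 0 <= kap -> 0 < k ->
  0 <= m -> 1 < p -> 1 < q -> 0 <= S <= T -> 0 < X0 ->
  X0 <= x 0 -> 0 <= y 0 ->
  feedback kap k m p q T x dx y dy ->
  (T - S) `^ (p + 1) * (k `^ (p + 1) * expR (kap * (p * S - T)) *
    (1 + T) `^ (- (m * (p * q - 1))) * X0 `^ (p * q - 1)) <=
  (2 / (1 - 2 `^ (- ((p * q - 1) / (p + 1))))) `^ (p + 1).
Proof.
move=> kap0 k0 m0 p1 q1 /andP[S0 ST] X00 X0x y0 [dd cx cy ddge].
have p0 : 0 < p by exact: lt_trans p1.
have q0 : 0 < q by exact: lt_trans q1.
have T10 : 0 < 1 + T by rewrite ltr_wpDr// (le_trans S0).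
have fincr f df : (forall t, 0 < t < T -> is_derive t 1 f (df t)) ->
    {within `[0, T], continuous f} -> (forall t, 0 < t < T -> 0 <= df t) ->
    f 0 <= f S.
  move=> fdf cf df0; have := @MVT_lower_bound f df 0 S 0 S0; rewrite mul0r addr0; apply.
  - by move=> t /andP[t0 tS]; apply: fdf; rewrite t0 (lt_le_trans tS ST).
  - apply: continuous_subspaceW cf => z /=; rewrite !in_itv/= => /andP[-> zb].
    exact: le_trans zb ST.
  - by move=> t /andP[t0 tS]; apply: df0; rewrite t0 (lt_le_trans tS ST).
have in0T t : S < t < T -> 0 < t < T.
  by move=> /andP[St ->]; rewrite (le_lt_trans S0 St).
have cSub f : {within `[0, T], continuous f} -> {within `[S, T], continuous f}.
  move=> cf; apply: continuous_subspaceW cf => z /=; rewrite !in_itv/=.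
  by move=> /andP[Sz ->]; rewrite (le_trans S0 Sz).
have xS : X0 <= x S.
  rewrite (le_trans X0x)//; apply: (fincr x dx) => // t tT; first by have [] := dd t tT.
  have [+ _] := ddge t tT; apply: le_trans.
  by rewrite !mulr_ge0 ?powR_ge0 ?expR_ge0// ltW.
have yS : 0 <= y S.
  rewrite (le_trans y0)//; apply: (fincr y dy) => // t tT; first by have [] := dd t tT.
  have [_] := ddge t tT; apply: le_trans.
  by rewrite !mulr_ge0 ?powR_ge0 ?expR_ge0// ltW.
set al := k * expR (- kap * T) * (1 + T) `^ (- (m * (p - 1))).
set be := k * expR (kap * S) * (1 + T) `^ (- (m * (q - 1))).
have al0 : 0 < al by rewrite !mulr_gt0 ?expR_gt0 ?powR_gt0.
have be0 : 0 < be by rewrite !mulr_gt0 ?expR_gt0 ?powR_gt0.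
have dx_al t : S < t < T -> al * y t `^ p <= dx t.
  move=> tT; have [+ _] := ddge t (in0T _ tT); apply: le_trans.
  rewrite ler_wpM2r ?powR_ge0//.
  apply: ler_pM; rewrite ?mulr_ge0 ?powR_ge0 ?expR_ge0 ?(ltW k0)//.
    rewrite ler_pM2l// ler_expR !mulNr lerN2 ler_wpM2l//.
    by move/andP: tT => [_ /ltW].
  by apply: weight_decreasing => //; exact: in0T.
have dy_be t : S < t < T -> be * x t `^ q <= dy t.
  move=> tT; have [_] := ddge t (in0T _ tT); apply: le_trans.
  rewrite ler_wpM2r ?powR_ge0//.
  apply: ler_pM; rewrite ?mulr_ge0 ?powR_ge0 ?expR_ge0 ?(ltW k0)//.
    rewrite ler_pM2l// ler_expR ler_wpM2l//.
    by move/andP: tT => [/ltW].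
  by apply: weight_decreasing => //; exact: in0T.
have pq1 : 1 < p * q by rewrite -[ltLHS]mulr1; apply: ltr_pM.
have := @coupled_blowup x dx y dy S T p q al be p0 q0 al0 be0
  (fun t tT => (dd t (in0T t tT)).1) (fun t tT => (dd t (in0T t tT)).2)
  (cSub _ cx) (cSub _ cy) dx_al dy_be yS X0 pq1 ST X00 xS.
apply: le_trans.
rewrite le_eqVlt; apply/orP; left; apply/eqP; congr (_ * (_ * _)).
have e0 : 0 <= expR (kap * S) by exact: expR_ge0.
rewrite /al /be (@powRM _ (k * expR (kap * S))) ?powR_ge0//; last first.
  by rewrite mulr_ge0// ltW.
rewrite (@powRM _ k) ?(ltW k0)// -expRM.
have -> : k `^ (p + 1) = k * k `^ p.
  by rewrite addrC powRD ?powRr1 ?(ltW k0)// (gt_eqF k0) implybT.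
have -> : expR (kap * (p * S - T)) = expR (- kap * T) * expR (kap * S * p).
  by rewrite -expRD; congr expR; ring.
have -> : (1 + T) `^ (- (m * (p * q - 1))) =
    (1 + T) `^ (- (m * (p - 1))) * (1 + T) `^ (- (m * (q - 1))) `^ p.
  rewrite -powRrM -powRD; last by rewrite (gt_eqF T10) implybT.
  by congr (_ `^ _); ring.
ring.
Qed.

(** With equal rates the window is the whole interval [[0, T]]. *)
Lemma resonant_lifespan k m p q a : 0 < k -> 0 <= m -> 1 < p -> 1 < q -> 0 < a ->
  0 < (p + 1) / (p * q - 1) - m ->
  exists2 C, 0 < C & forall eps T x dx y dy, 0 < eps < 1 -> 0 <= T ->
    a * eps <= x 0 -> 0 <= y 0 -> feedback 0 k m p q T x dx y dy ->
    T <= C * eps `^ (- ((p + 1) / (p * q - 1) - m)^-1).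
Proof.
move=> k0 m0 p1 q1 a0 G0; set G := (X in 0 < X) in G0 *.
have p0 : 0 < p by exact: lt_trans p1.
have pq0 : 0 < p * q - 1 by rewrite subr_gt0 -[ltLHS]mulr1; apply: ltr_pM.
set r := p * q - 1 in pq0 *.
set Cb := 2 / (1 - 2 `^ (- (r / (p + 1)))).
set B := 2 `^ (- (p + 1)) * k `^ (p + 1) * a `^ r.
have B0 : 0 < B by rewrite !mulr_gt0// powR_gt0.
exists (1 + (Cb `^ (p + 1) / B) `^ (G * r)^-1).
  by rewrite ltr_pwDl// powR_ge0.
move=> eps T x dx y dy eps01 T0 ax y0 fb.
have eps0 : 0 < eps by case/andP: eps01.
have := powRN_inv_ge1 eps01 G0; set W := _ `^ (- G^-1) => W1.
have W0 : 0 <= W by rewrite (le_trans _ W1).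
have [T1|T1] := ltP T 1.
  rewrite (le_trans (ltW T1))// (le_trans W1)// ler_peMl//.
  by rewrite lerDl powR_ge0.
have T10 : 0 < 1 + T by rewrite ltr_wpDr.
rewrite (@le_trans _ _ (1 + T)) ?lerDr//.
rewrite (@le_trans _ _ ((Cb `^ (p + 1) / B) `^ (G * r)^-1 * W)) ?ler_wpM2r ?lerDr//.
apply: solve_powR_le => //.
have := @feedback_window 0 k m p q T x dx y dy 0 (a * eps) (lexx _) k0 m0 p1 q1.
rewrite lexx T0 => /(_ isT (mulr_gt0 a0 eps0) ax y0 fb).
rewrite subr0 mul0r expR0 mulr1 -/r -/Cb; apply: le_trans.
have -> : (1 + T) `^ (G * r) = (1 + T) `^ (p + 1) * (1 + T) `^ (- (m * r)).
  rewrite -powRD; last by rewrite (gt_eqF T10) implybT.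
  by congr (_ `^ _); rewrite /G mulrBl divfK ?gt_eqF.
rewrite (@powRM _ a eps r (ltW a0) (ltW eps0)).
rewrite [leLHS](_ : _ = (2 `^ (- (p + 1)) * (1 + T) `^ (p + 1)) *
  (k `^ (p + 1) * (1 + T) `^ (- (m * r)) * (a `^ r * eps `^ r))); last by rewrite /B; ring.
rewrite ler_wpM2r ?mulr_ge0 ?powR_ge0//.
(* It remains to see that (1 + T) / 2 <= T. *)
rewrite powRN -powR_inv1 ?powR_ge0// -powRrM mulrN1 -mulN1r powRrM.
rewrite -powRM ?powR_ge0 ?(ltW T10)// powR_inv1//.
apply: ge0_ler_powR; rewrite ?nnegrE ?mulr_ge0 ?invr_ge0 ?(ltW T10) ?addr_ge0 ?(ltW p0)//.
by rewrite ler_pdivrMl//; lra.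
Qed.

(** The window [[T - 1, T]] leaves the factor [exp ((p - 1) kap T)] against a power
    of [1 + T], so that [G] is arbitrary: [N] is the power of [1 + T] that has to be
    paid to reach it. *)
Lemma nonresonant_lifespan kap G k m p q a : 0 < kap -> 0 < G -> 0 < k ->
  0 <= m -> 1 < p -> 1 < q -> 0 < a ->
  exists2 C, 0 < C & forall eps T x dx y dy, 0 < eps < 1 -> 0 <= T ->
    a * eps <= x 0 -> 0 <= y 0 -> feedback kap k m p q T x dx y dy ->
    T <= C * eps `^ (- G^-1).
Proof.
move=> kap0 G0 k0 m0 p1 q1 a0.
have p0 : 0 < p by exact: lt_trans p1.
have pq0 : 0 < p * q - 1 by rewrite subr_gt0 -[ltLHS]mulr1; apply: ltr_pM.
set r := p * q - 1 in pq0 *.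
set Cb := 2 / (1 - 2 `^ (- (r / (p + 1)))).
set N := (m + G) * r; set de := (p - 1) * kap.
have N0 : 0 < N by rewrite mulr_gt0// ltr_wpDl.
have de0 : 0 < de by rewrite mulr_gt0// subr_gt0.
set B := k `^ (p + 1) * expR (- (kap * p + de)) * (de / N) `^ N * a `^ r.
have B0 : 0 < B by rewrite !mulr_gt0 ?powR_gt0 ?expR_gt0// divr_gt0.
exists (1 + (Cb `^ (p + 1) / B) `^ (G * r)^-1).
  by rewrite ltr_pwDl// powR_ge0.
move=> eps T x dx y dy eps01 T0 ax y0 fb.
have eps0 : 0 < eps by case/andP: eps01.
have := powRN_inv_ge1 eps01 G0; set W := _ `^ (- G^-1) => W1.
have W0 : 0 <= W by rewrite (le_trans _ W1).
have [T1|T1] := ltP T 1.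
  rewrite (le_trans (ltW T1))// (le_trans W1)// ler_peMl//.
  by rewrite lerDl powR_ge0.
have T10 : 0 < 1 + T by rewrite ltr_wpDr.
rewrite (@le_trans _ _ (1 + T)) ?lerDr//.
rewrite (@le_trans _ _ ((Cb `^ (p + 1) / B) `^ (G * r)^-1 * W)) ?ler_wpM2r ?lerDr//.
apply: solve_powR_le => //.
have := @feedback_window kap k m p q T x dx y dy (T - 1) (a * eps) (ltW kap0) k0 m0 p1 q1.
rewrite subr_ge0 T1 gerBl ler01 => /(_ isT (mulr_gt0 a0 eps0) ax y0 fb).
rewrite opprB addrC subrK powR1 mul1r -/r -/Cb; apply: le_trans.
have expo := powR_le_expR de0 N0 T0.
have -> : (1 + T) `^ (G * r) = (1 + T) `^ N * (1 + T) `^ (- (m * r)).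
  rewrite -powRD; last by rewrite (gt_eqF T10) implybT.
  by congr (_ `^ _); rewrite /N; ring.
have -> : expR (kap * (p * (T - 1) - T)) = expR (- (kap * p + de)) * expR (de * (1 + T)).
  by rewrite -expRD; congr expR; rewrite /de; ring.
rewrite (@powRM _ a eps r (ltW a0) (ltW eps0)).
rewrite [leLHS](_ : _ = ((de / N) `^ N * (1 + T) `^ N) *
  (k `^ (p + 1) * expR (- (kap * p + de)) * (1 + T) `^ (- (m * r)) * (a `^ r * eps `^ r)));
  last by rewrite /B; ring.
rewrite [leRHS](_ : _ = expR (de * (1 + T)) *
  (k `^ (p + 1) * expR (- (kap * p + de)) * (1 + T) `^ (- (m * r)) * (a `^ r * eps `^ r)));
  last by ring.
by rewrite ler_wpM2r// !mulr_ge0 ?powR_ge0 ?expR_ge0.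
Qed.

End blowup.

(** * Calculus of smooth functions *)

Section smooth_calculus.
Context {R : realType} {n : nat}.
Local Notation V := 'rV[R]_n.
Implicit Types (f h : V -> R) (x : V) (i : 'I_n) (k : nat).

Lemma is_derive_chain (h : R -> R) f x v dh df :
  is_derive x v f df -> is_derive (f x) 1 h dh ->
  is_derive x v (h \o f) (dh * df).
Proof.
move=> fd hd.
have line (e : V -> R) : (fun t : R => t^-1 *: ((e \o shift x) (t *: v) - e x)) =
    (fun t : R => t^-1 *: (((fun s : R => e (s *: v + x)) \o shift 0) (t *: 1) -
      e (0 *: v + x))).
  by apply/funext => t /=; rewrite addr0 scale0r add0r [_%:A]mulr1.
have f1 : is_derive (0:R) 1 (fun s : R => f (s *: v + x)) df.
  apply: DeriveDef; first by apply/(derivable1P f x v); exact: (@ex_derive _ _ _ _ _ _ _ fd).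
  by rewrite -[RHS](@derive_val _ _ _ _ _ _ _ fd) /derive line.
have h1 : is_derive ((fun s : R => f (s *: v + x)) 0) 1 h dh.
  by rewrite /= scale0r add0r.
have hf : is_derive (0:R) 1 (fun s : R => h (f (s *: v + x))) (dh * df).
  by have := @is_derive1_comp _ h (fun s : R => f (s *: v + x)) 0 dh df h1 f1.
apply: DeriveDef; first by apply/derivable1P; exact: (@ex_derive _ _ _ _ _ _ _ hf).
by rewrite -[RHS](@derive_val _ _ _ _ _ _ _ hf) /derive line.
Qed.

(** Smoothness is a condition on all words of partial derivatives; counting the
    order instead allows inductions that differentiate on the outside. *)
Fixpoint Ck k f : Prop :=
  if k is k'.+1 then
    [/\ continuous f, forall i x, derivable f x (delta_mx 0 i) &
        forall i, Ck k' (pd i f)]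
  else continuous f.

Lemma CkS k f : Ck k.+1 f -> Ck k f.
Proof.
elim: k f => [|k IH] f; first by case.
by move=> [cf df H]; split => // i; apply: IH; exact: H.
Qed.

Lemma smooth_pd i f : smooth f -> smooth (pd i f).
Proof.
move=> sf s; have := sf (rcons s i).
by rewrite /pderiv -cats1 foldr_cat.
Qed.

Lemma smoothP f : smooth f <-> forall k, Ck k f.
Proof.
split=> [sf k|].
  elim: k f sf => [|k IH] f sf; first by have [] := sf [::].
  split; first by have [] := sf [::].
  - by move=> i x; have [_] := sf [::]; exact.
  - by move=> i; apply: IH; exact: smooth_pd.
move=> Ckf s; elim/last_ind: s f Ckf => [|s i IH] f Ckf.
  by have [] := Ckf 1%N.
have := IH (pd i f) (fun k => let: And3 _ _ H := Ckf k.+1 in H i).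
by rewrite /pderiv -cats1 foldr_cat.
Qed.

Lemma pdE i f x df : is_derive x (delta_mx 0 i) f df -> pd i f x = df.
Proof. by move=> fd; rewrite /pd derive_val. Qed.

Lemma Ck_cst k (a : R) : Ck k (fun=> a).
Proof.
elim: k a => [|k IH] a; first exact: cst_continuous.
split; first exact: cst_continuous.
- by move=> i x; exact: derivable_cst.
- move=> i; rewrite (_ : pd i _ = fun=> 0)//.
  by apply/funext => x; apply: pdE; exact: is_derive_cst.
Qed.

Lemma CkD k f h : Ck k f -> Ck k h -> Ck k (fun x => f x + h x).
Proof.
elim: k f h => [|k IH] f h.
  by move=> cf ch x; exact: cvgD (cf x) (ch x).
move=> [cf df Df] [ch dh Dh]; split.
- by move=> x; exact: cvgD (cf x) (ch x).
- by move=> i x; exact: derivableD.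
- move=> i; rewrite (_ : pd i _ = fun x => pd i f x + pd i h x).
    exact: (IH _ _ (Df i) (Dh i)).
  by apply/funext => x; apply: pdE; apply: is_deriveD; exact: derivableP.
Qed.

Lemma CkM k f h : Ck k f -> Ck k h -> Ck k (fun x => f x * h x).
Proof.
elim: k f h => [|k IH] f h.
  by move=> cf ch x; exact: cvgM (cf x) (ch x).
move=> Hf Hh; move: (Hf) (Hh) => [cf df Df] [ch dh Dh]; split.
- by move=> x; exact: cvgM (cf x) (ch x).
- by move=> i x; exact: derivableM.
- move=> i; rewrite (_ : pd i _ = fun x => f x * pd i h x + h x * pd i f x).
    exact: (CkD (IH _ _ (CkS Hf) (Dh i)) (IH _ _ (CkS Hh) (Df i))).
  by apply/funext => x; apply: pdE; apply: is_deriveM; exact: derivableP.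
Qed.

Lemma CkV k f : (forall x, f x != 0) -> Ck k f -> Ck k (fun x => (f x)^-1).
Proof.
move=> f0; elim: k => [|k IH].
  by move=> cf x; exact: cvgV (f0 x) (cf x).
move=> Hf; move: (Hf) => [cf df Df]; split.
- by move=> x; exact: cvgV (f0 x) (cf x).
- by move=> i x; exact: derivableV.
- move=> i; rewrite (_ : pd i _ = fun x => (-1) * ((f x)^-1 * (f x)^-1) * pd i f x).
    apply: CkM (Df i); apply: CkM; first exact: Ck_cst.
    by apply: CkM; apply: IH; exact: CkS.
  apply/funext => x; rewrite /pd deriveV//; congr (_ * _).
  by rewrite mulN1r -exprVn expr2.
Qed.

Lemma Ck_sqrt k f : (forall x, 0 < f x) -> Ck k f ->
  Ck k (fun x => Num.sqrt (f x)).
Proof.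
move=> f0; elim: k => [|k IH].
  by move=> cf x; apply: (@continuous_comp _ _ _ f Num.sqrt);
    [exact: cf|exact: sqrt_continuous].
have fd x v df : is_derive x v f df ->
    is_derive x v (Num.sqrt \o f) ((2 * Num.sqrt (f x))^-1 * df).
  by move=> fd; apply: is_derive_chain; exact: is_derive1_sqrt.
move=> Hf; move: (Hf) => [cf df Df]; split.
- by move=> x; apply: (@continuous_comp _ _ _ f Num.sqrt);
    [exact: cf|exact: sqrt_continuous].
- by move=> i x; have [] := fd _ _ _ (derivableP (df i x)).
- move=> i; rewrite (_ : pd i _ = fun x => (2 * Num.sqrt (f x))^-1 * pd i f x).
    apply: CkM (Df i); apply: CkV.
      by move=> x; rewrite mulf_neq0// gt_eqF// sqrtr_gt0.
    apply: CkM; first exact: Ck_cst.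
    by apply: IH; exact: CkS.
  by apply/funext => x; apply: pdE; apply: fd; exact: derivableP.
Qed.

Lemma smooth_cst (a : R) : smooth (fun _ : V => a).
Proof. by apply/smoothP => k; exact: Ck_cst. Qed.

Lemma smoothD f h : smooth f -> smooth h -> smooth (fun x => f x + h x).
Proof. by move=> /smoothP sf /smoothP sh; apply/smoothP => k; exact: CkD. Qed.

Lemma smoothM f h : smooth f -> smooth h -> smooth (fun x => f x * h x).
Proof. by move=> /smoothP sf /smoothP sh; apply/smoothP => k; exact: CkM. Qed.

Lemma smoothZ (a : R) f : smooth f -> smooth (fun x => a * f x).
Proof. exact/smoothM/smooth_cst. Qed.

Lemma smoothB f h : smooth f -> smooth h -> smooth (fun x => f x - h x).
Proof.
move=> sf sh; have -> : (fun x => f x - h x) = fun x => f x + (-1) * h x.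
  by apply/funext => x; rewrite mulN1r.
exact/smoothD/smoothZ.
Qed.

Lemma smoothV f : (forall x, f x != 0) -> smooth f -> smooth (fun x => (f x)^-1).
Proof. by move=> f0 /smoothP sf; apply/smoothP => k; exact: CkV. Qed.

Lemma smooth_sqrt f : (forall x, 0 < f x) -> smooth f ->
  smooth (fun x => Num.sqrt (f x)).
Proof. by move=> f0 /smoothP sf; apply/smoothP => k; exact: Ck_sqrt. Qed.

Lemma smooth_sum (I : Type) (s : seq I) (P : pred I) (F : I -> V -> R) :
  (forall j, smooth (F j)) -> smooth (fun x => \sum_(j <- s | P j) F j x).
Proof.
move=> sF; elim: s => [|j s IH].
  have -> : (fun x => \sum_(i <- [::] | P i) F i x) = fun=> 0.
    by apply/funext => x; rewrite big_nil.
  exact: smooth_cst.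
have -> : (fun x => \sum_(i <- j :: s | P i) F i x) = if P j
    then fun x => F j x + \sum_(i <- s | P i) F i x else fun x => \sum_(i <- s | P i) F i x.
  by apply/funext => x; rewrite big_cons; case: (P j).
by case: (P j); [exact: (smoothD (sF j) IH)|exact: IH].
Qed.

Lemma smooth_prod (I : Type) (s : seq I) (P : pred I) (F : I -> V -> R) :
  (forall j, smooth (F j)) -> smooth (fun x => \prod_(j <- s | P j) F j x).
Proof.
move=> sF; elim: s => [|j s IH].
  have -> : (fun x => \prod_(i <- [::] | P i) F i x) = fun=> 1.
    by apply/funext => x; rewrite big_nil.
  exact: smooth_cst.
have -> : (fun x => \prod_(i <- j :: s | P i) F i x) = if P j
    then fun x => F j x * \prod_(i <- s | P i) F i x else fun x => \prod_(i <- s | P i) F i x.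
  by apply/funext => x; rewrite big_cons; case: (P j).
by case: (P j); [exact: (smoothM (sF j) IH)|exact: IH].
Qed.

Lemma smooth_coord j : smooth (fun x : V => x 0 j).
Proof.
have cc : continuous (fun x : V => x 0 j) by exact: coord_continuous.
have dd i x : is_derive x (delta_mx 0 i) (fun x : V => x 0 j) ((i == j)%:R).
  have @l : {linear V -> R}.
    by exists (fun y : V => y 0 j); do 2![eexists]; do ?[constructor];
       rewrite ?mxE// => ? *; rewrite ?mxE//; move=> ?; rewrite !mxE.
  have dl : differentiable l x by exact/linear_differentiable/cc.
  apply: DeriveDef; first by apply: (@diff_derivable _ _ _ l).
  rewrite -[LHS]/('D_(delta_mx 0 i) l x) deriveE// diff_lin//.
  by rewrite -[LHS]/((delta_mx 0 i : V) 0 j) mxE eqxx eq_sym.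
apply/smoothP => -[//|k]; split; first exact: cc.
- by move=> i x; have [] := dd i x.
- move=> i; rewrite (_ : pd i _ = fun=> (i == j)%:R); first exact: Ck_cst.
  by apply/funext => x; exact: pdE.
Qed.

Lemma smooth_continuous f : smooth f -> continuous f.
Proof. by move=> /(_ [::]) []. Qed.

Lemma smooth_det m (A : V -> 'M[R]_m) : (forall a b, smooth (fun x => A x a b)) ->
  smooth (fun x => \det (A x)).
Proof.
move=> sA; rewrite /determinant; apply: smooth_sum => s.
by apply: smoothZ; apply: smooth_prod => a; exact: sA.
Qed.

Lemma smooth_invmx m (A : V -> 'M[R]_m) : (forall x, \det (A x) != 0) ->
  (forall a b, smooth (fun x => A x a b)) ->
  forall a b, smooth (fun x => invmx (A x) a b).
Proof.
move=> dA sA a b.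
rewrite (_ : (fun x => _) = fun x => (\det (A x))^-1 * ((-1) ^+ (b + a) *
    \det (row' b (col' a (A x))))); last first.
  by apply/funext => x; rewrite /invmx unitmxE unitfE dA mxE mxE.
apply: smoothM; first by apply: smoothV => //; exact: smooth_det.
apply: smoothZ; apply: smooth_det => c d.
rewrite (_ : (fun x => _) = fun x => A x (lift b c) (lift a d)); first exact: sA.
by apply/funext => x; rewrite !mxE.
Qed.

End smooth_calculus.

(** * Smooth cutoffs and test functions *)

Section flat_functions.
Context {R : realType}.
Implicit Types (s t : R) (k : nat).

(** The functions [s^(- k) exp (- 1 / s)]: the family is closed under
    differentiation up to linear combinations, hence made of smooth functions. *)
Definition flat k s : R := if 0 < s then s ^- k * expR (- s^-1) else 0.

Lemma flat_le0 k s : s <= 0 -> flat k s = 0.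
Proof. by rewrite /flat ltNge => ->. Qed.

Lemma flat_gt0 k s : 0 < s -> 0 < flat k s.
Proof. by move=> s0; rewrite /flat s0 mulr_gt0 ?expR_gt0// invr_gt0 exprn_gt0. Qed.

Lemma flat_ge0 k s : 0 <= flat k s.
Proof. by have [/(flat_gt0 k)/ltW//|/(flat_le0 k)->] := ltP 0 s. Qed.

(** Together with [flat_bounded], shows that every [flat k] vanishes to infinite
    order at 0. *)
Lemma flatS k s : s * flat k.+1 s = flat k s.
Proof.
rewrite /flat; case: ifPn => [s0|_]; last by rewrite mulr0.
by rewrite mulrA; congr (_ * _); rewrite exprS; field; rewrite expf_neq0 gt_eqF.
Qed.

Lemma flat_bounded k s : flat k s <= k`!%:R.
Proof.
have [s0|s0] := ltP 0 s; last by rewrite flat_le0.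
rewrite /flat s0 expRN ler_pdivrMr ?expR_gt0// -exprVn.
case: k => [|k].
  by rewrite expr0 fact0 mul1r -expR0 ler_expR invr_ge0 ltW.
have := @expR_ge1Dxn R (s^-1) k; rewrite invr_ge0 => /(_ (ltW s0)) h.
rewrite mulrC -ler_pdivrMr ?ltr0n ?fact_gt0//.
by apply: le_trans h; rewrite lerDr.
Qed.

Lemma is_derive_flat k s :
  is_derive s 1 (flat k) (- k%:R * flat k.+1 s + flat k.+2 s).
Proof.
have [s0|s0|->] := ltgtP s 0.
- rewrite !flat_le0 ?(ltW s0)// mulr0 addr0.
  apply: (@near_eq_is_derive _ _ _ (fun=> 0)).
    near=> t; rewrite flat_le0// ltW//; near: t; exact: lt_nbhsl.
- apply: (@near_eq_is_derive _ _ _ (fun t => t ^- k * expR (- t^-1))).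
    near=> t; rewrite /flat ifT//; near: t; exact: lt_nbhsr.
  have sn0 : s != 0 by rewrite gt_eqF.
  have dV : is_derive s 1 (fun t => t^-1) (- s ^- 2).
    have := @is_deriveV _ (@id R) s 1 1 sn0 (is_derive_id _ _).
    by rewrite /= [_ *: 1]mulr1.
  have dk : is_derive s 1 (fun t => t ^- k) (- k%:R * s ^- k.+1).
    rewrite (_ : (fun t => t ^- k) = (fun t : R => t^-1) ^+ k); last first.
      by apply/funext => t; rewrite exprfctE exprVn.
    apply: is_derive_eq; rewrite /= [_ *: _]mulrN mulNr; congr (- _).
    rewrite -mulrA; case: k => [|k]; first by rewrite !mul0r.
    by rewrite /= exprVn; congr (_ * _); rewrite !exprS; field; rewrite expf_neq0.
  have de : is_derive s 1 (fun t => expR (- t^-1)) (expR (- s^-1) * s ^- 2).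
    have dN : is_derive s 1 (fun t => - t^-1) (s ^- 2).
      by rewrite -[s ^- 2]opprK; apply: is_deriveN.
    exact: (@is_derive1_comp _ expR (fun t => - t^-1) s _ _ (is_derive_expR _) dN).
  apply: (is_derive_eq (is_deriveM dk de)).
  rewrite /flat s0 [_ *: _]mulrC [X in _ + X]mulrC /=.
  by rewrite !exprS; field; rewrite expf_neq0.
- rewrite !(flat_le0 _ (lexx 0)) mulr0 addr0.
  have lim0 : h^-1 *: ((flat k \o shift 0) (h *: (1:R)) - flat k 0) @[h --> 0^'] --> (0:R).
    apply/cvgr0Pnorm_le => e e0; near=> h.
    have h0 : h != 0 by near: h; exact: nbhs_dnbhs_neq.
    rewrite /= addr0 [h *: _]mulr1 (flat_le0 _ (lexx 0)) subr0.
    rewrite -flatS -flatS [_ *: _]mulKf// normrM [X in _ * X]ger0_norm ?flat_ge0//.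
    rewrite (@le_trans _ _ (`|h| * (k.+2)`!%:R)) ?ler_wpM2l ?flat_bounded//.
    rewrite -ler_pdivlMr ?ltr0n ?fact_gt0//; near: h.
    apply: dnbhs0_le; by rewrite divr_gt0// ltr0n fact_gt0.
  apply: DeriveDef; last exact: cvg_lim lim0.
  by apply/cvg_ex; exists 0.
Unshelve. all: by end_near. Qed.
End flat_functions.

Section cutoffs.
Context {R : realType} {n : nat}.
Local Notation V := 'rV[R]_n.
Implicit Types (f h psi theta : V -> R) (x y : V) (k : nat) (r : R).

Lemma Ck_flat k j f : Ck k f -> Ck k (fun x => flat j (f x)).
Proof.
have cflat m : continuous (@flat R m).
  move=> s; apply/differentiable_continuous/derivable1_diffP.
  exact: (@ex_derive _ _ _ _ _ _ _ (is_derive_flat m s)).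
elim: k j => [|k IH] j Hf.
  by move=> x; apply: (@continuous_comp _ _ _ f (flat j)); [exact: Hf|exact: cflat].
move: (Hf) => [cf df Df].
have dd x v a : is_derive x v f a ->
    is_derive x v (flat j \o f) ((- j%:R * flat j.+1 (f x) + flat j.+2 (f x)) * a).
  by move=> fd; apply: is_derive_chain fd (is_derive_flat _ _).
split.
- by move=> x; apply: (@continuous_comp _ _ _ f (flat j)); [exact: cf|exact: cflat].
- by move=> i x; have [] := dd _ _ _ (derivableP (df i x)).
- move=> i; rewrite (_ : pd i _ = fun x =>
    (- j%:R * flat j.+1 (f x) + flat j.+2 (f x)) * pd i f x); last first.
    by apply/funext => x; apply: pdE; apply: dd; exact: derivableP.
  apply: CkM (Df i).
  exact: (CkD (CkM (Ck_cst _ _) (IH j.+1 (CkS Hf))) (IH j.+2 (CkS Hf))).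
Qed.

Lemma smooth_flat j f : smooth f -> smooth (fun x => flat j (f x)).
Proof. by move=> /smoothP sf; apply/smoothP => k; exact: Ck_flat. Qed.

Definition smooth_step (s : R) : R := flat 0 s / (flat 0 s + flat 0 (1 - s)).

Lemma smooth_step_den (s : R) : 0 < flat 0 s + flat 0 (1 - s).
Proof.
have [s0|s0] := ltP 0 s; first by rewrite ltr_pwDl ?flat_gt0 ?flat_ge0.
by rewrite ltr_wpDl ?flat_ge0// flat_gt0// subr_gt0 (le_lt_trans s0).
Qed.

Lemma smooth_step_ge0 s : 0 <= smooth_step s.
Proof. by rewrite divr_ge0 ?flat_ge0// ltW// smooth_step_den. Qed.

Lemma smooth_step_le1 s : smooth_step s <= 1.
Proof. by rewrite ler_pdivrMr ?smooth_step_den// mul1r lerDl flat_ge0. Qed.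

Lemma smooth_step_le0 s : s <= 0 -> smooth_step s = 0.
Proof. by move=> s0; rewrite /smooth_step flat_le0// mul0r. Qed.

Lemma smooth_step_ge1 s : 1 <= s -> smooth_step s = 1.
Proof.
move=> s1; rewrite /smooth_step (@flat_le0 _ 0 (1 - s)) ?subr_le0// addr0 divff//.
by rewrite gt_eqF// flat_gt0// (lt_le_trans _ s1).
Qed.

Lemma smooth_smooth_step f : smooth f -> smooth (fun x => smooth_step (f x)).
Proof.
move=> sf; apply: smoothM; first exact: smooth_flat.
apply: smoothV; first by move=> x; rewrite gt_eqF// smooth_step_den.
apply: smoothD; first exact: smooth_flat.
by apply: smooth_flat; apply: smoothB => //; exact: smooth_cst.
Qed.

Lemma enorm_ge0 x : 0 <= enorm x.
Proof. exact: sqrtr_ge0. Qed.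

Lemma enorm_sqr x : enorm x ^+ 2 = \sum_i x 0 i ^+ 2.
Proof. by rewrite sqr_sqrtr// sumr_ge0// => i _; rewrite sqr_ge0. Qed.

Lemma enorm_coord x i : `|x 0 i| <= enorm x.
Proof.
rewrite -sqrtr_sqr ler_sqrt; last by rewrite sumr_ge0// => j _; rewrite sqr_ge0.
by rewrite (bigD1 i)//= lerDl sumr_ge0// => j _; rewrite sqr_ge0.
Qed.

Lemma smooth_enorm_sqr y : smooth (fun x => enorm (x - y) ^+ 2).
Proof.
rewrite (_ : (fun x => _) = fun x => \sum_i (x 0 i - y 0 i) * (x 0 i - y 0 i)).
  apply: smooth_sum => i; have sc : smooth (fun x : V => x 0 i - y 0 i).
    by apply: smoothB; [exact: smooth_coord|exact: smooth_cst].
  exact: (smoothM sc sc).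
apply/funext => x; rewrite enorm_sqr; apply: eq_bigr => i _.
by rewrite !mxE expr2.
Qed.

Lemma continuous_enormB y : continuous (fun x => enorm (x - y)).
Proof.
have -> : (fun x => enorm (x - y)) = (fun x => Num.sqrt (enorm (x - y) ^+ 2)).
  by apply/funext => x; rewrite sqrtr_sqr ger0_norm ?enorm_ge0.
move=> x; apply: (@continuous_comp _ _ _ (fun x => enorm (x - y) ^+ 2) Num.sqrt).
  exact: (smooth_continuous (smooth_enorm_sqr y)).
exact: sqrt_continuous.
Qed.

Lemma continuous_enorm : continuous (@enorm R n).
Proof.
have -> : @enorm R n = fun x => enorm (x - 0) by apply/funext => x; rewrite subr0.
exact: continuous_enormB.
Qed.

(** Composing with the square of the distance keeps the cutoff smooth at [y]. *)
Definition cutoff y (r1 r2 : R) x : R :=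
  smooth_step ((r2 ^+ 2 - enorm (x - y) ^+ 2) / (r2 ^+ 2 - r1 ^+ 2)).

Lemma smooth_cutoff y r1 r2 : smooth (cutoff y r1 r2).
Proof.
apply: smooth_smooth_step.
rewrite (_ : (fun x => _) = fun x =>
  (r2 ^+ 2 - r1 ^+ 2)^-1 * (r2 ^+ 2 - enorm (x - y) ^+ 2)).
  apply: smoothZ; apply: smoothB; [exact: smooth_cst|exact: smooth_enorm_sqr].
by apply/funext => x; rewrite mulrC.
Qed.

Lemma cutoff_ge0 y r1 r2 x : 0 <= cutoff y r1 r2 x.
Proof. exact: smooth_step_ge0. Qed.

Lemma cutoff_le1 y r1 r2 x : cutoff y r1 r2 x <= 1.
Proof. exact: smooth_step_le1. Qed.

Lemma cutoff_in y r1 r2 x : 0 <= r1 < r2 -> enorm (x - y) <= r1 ->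
  cutoff y r1 r2 x = 1.
Proof.
move=> /andP[r10 r12] xr; apply: smooth_step_ge1.
have r : 0 < r2 ^+ 2 - r1 ^+ 2.
  by rewrite subr_gt0 ltrXn2r ?nnegrE//= (le_trans r10) ?ltW.
rewrite ler_pdivlMr// mul1r lerD2l lerN2 lerXn2r ?nnegrE ?enorm_ge0//.
Qed.

Lemma cutoff_out y r1 r2 x : 0 <= r1 < r2 -> r2 <= enorm (x - y) ->
  cutoff y r1 r2 x = 0.
Proof.
move=> /andP[r10 r12] xr; apply: smooth_step_le0.
have r : 0 < r2 ^+ 2 - r1 ^+ 2.
  by rewrite subr_gt0 ltrXn2r ?nnegrE//= (le_trans r10) ?ltW.
rewrite ler_pdivrMr// mul0r subr_le0 lerXn2r ?nnegrE ?enorm_ge0//.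
by rewrite (le_trans r10) ?ltW.
Qed.

Lemma closed_enormB_le y r : closed [set x | enorm (x - y) <= r].
Proof.
rewrite (_ : mkset _ = (fun x => enorm (x - y)) @^-1` [set z | z <= r])//.
by apply: preimage_closed; [move=> x _; exact: continuous_enormB|exact: closed_le].
Qed.

Lemma open_enormB_lt y r : open [set x | enorm (x - y) < r].
Proof.
rewrite (_ : mkset _ = (fun x => enorm (x - y)) @^-1` [set z | z < r])//.
by apply: open_comp; [move=> x _; exact: continuous_enormB|exact: open_lt].
Qed.

Lemma compact_enorm_le r : compact [set x : V | enorm x <= r].
Proof.
apply: bounded_closed_compact.
  exists r; split; first exact: num_real.
  move=> M rM x /= xr; rewrite [leLHS]/Num.norm/= mx_normrE.
  apply/bigmax_leP; split.
    by rewrite (le_trans (enorm_ge0 x))// (le_trans xr) ?ltW.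
  move=> [i j] _ /=; rewrite ord1 (le_trans (enorm_coord _ _))//.
  by rewrite (le_trans xr)// ltW.
rewrite (_ : mkset _ = [set x | enorm (x - 0) <= r]); first exact: closed_enormB_le.
by apply/seteqP; split=> x /=; rewrite subr0.
Qed.

Lemma tsupp_sub f (A : set V) : closed A -> (forall x, f x != 0 -> A x) ->
  tsupp f `<=` A.
Proof. by move=> cA fA; rewrite [A](closure_id A).1//; exact: closureS. Qed.

Lemma tsuppP f x : f x != 0 -> tsupp f x.
Proof. by move=> fx; exact: (@subset_closure _ [set z | f z != 0] x fx). Qed.

Lemma near_tsupp f x : ~ tsupp f x -> \forall y \near x, f y = 0.
Proof.
move=> nx; have : nbhs x (~` tsupp f).
  by apply: open_nbhs_nbhs; split => //; apply: closed_openC; exact: closed_closure.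
apply: filterS => y ny; apply/eqP; apply: contra_notT ny; exact: tsuppP.
Qed.

Lemma test_function_sub f theta : smooth f -> test_function theta ->
  (forall x, f x != 0 -> tsupp theta x) -> test_function f.
Proof.
move=> sf [st ct] ft; split => //.
apply: subclosed_compact ct _; first exact: closed_closure.
by apply: tsupp_sub => //; exact: closed_closure.
Qed.

Lemma test_functionM f theta : smooth f -> test_function theta ->
  test_function (fun x => f x * theta x).
Proof.
move=> sf ht; apply: (test_function_sub _ ht); first by case: ht => st _; exact: smoothM.
by move=> x; rewrite mulf_eq0 negb_or => /andP[_]; exact: tsuppP.
Qed.

Lemma test_functionD theta psi : test_function theta -> test_function psi ->
  test_function (fun x => theta x + psi x).
Proof.
move=> [st ct] [sp cp]; split; first exact: smoothD.
apply: (@subclosed_compact _ _ (tsupp theta `|` tsupp psi)).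
- exact: closed_closure.
- exact: compactU.
- apply: tsupp_sub; first by apply: closedU; exact: closed_closure.
  move=> x; have [->|t0 _] := eqVneq (theta x) 0; last by left; exact: tsuppP.
  by rewrite add0r => px; right; exact: tsuppP.
Qed.

Lemma test_functionZ (a : R) theta : test_function theta ->
  test_function (fun x => a * theta x).
Proof. by move=> ht; apply: test_functionM => //; exact: smooth_cst. Qed.

Lemma test_functionB theta psi : test_function theta -> test_function psi ->
  test_function (fun x => theta x - psi x).
Proof.
move=> ht hp; have -> : (fun x => theta x - psi x) = fun x => theta x + (-1) * psi x.
  by apply/funext => x; rewrite mulN1r.
exact/test_functionD/test_functionZ.
Qed.

Lemma test_cutoff (r1 r2 : R) : 0 <= r1 < r2 -> test_function (cutoff (0 : V) r1 r2).
Proof.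
move=> r12; split; first exact: smooth_cutoff.
apply: (@subclosed_compact _ _ [set x : V | enorm x <= r2]).
- exact: closed_closure.
- exact: compact_enorm_le.
- apply: tsupp_sub.
    rewrite (_ : mkset _ = [set x : V | enorm (x - 0) <= r2]); first exact: closed_enormB_le.
    by apply/seteqP; split=> x /=; rewrite subr0.
  move=> x; apply: contra_neqT; rewrite -ltNge => /ltW xr.
  by apply: cutoff_out => //; rewrite subr0.
Qed.

End cutoffs.

(** * The Laplace-Beltrami operator *)

Section laplacian.
Context {R : realType} {n : nat}.
Local Notation V := 'rV[R]_n.
Implicit Types (f h : V -> R) (x : V) (i : 'I_n) (g : V -> 'M[R]_n).

(** The determinant does not vanish along the segment from the identity to [A],
    which consists of positive definite matrices, so it keeps the sign it has at
    the identity. *)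
Lemma det_gt0 m (A : 'M[R]_m) :
  (forall xi : 'rV[R]_m, xi != 0 -> 0 < (xi *m A *m xi^T) 0 0) -> 0 < \det A.
Proof.
move=> Apos.
have sq_gt0 (xi : 'rV[R]_m) : xi != 0 -> 0 < (xi *m xi^T) 0 0.
  move=> xi0; rewrite mxE lt_neqAle sumr_ge0 ?andbT; last first.
    by move=> i _; rewrite mxE -expr2 sqr_ge0.
  apply: contra_neq xi0 => /esym/eqP.
  rewrite psumr_eq0; last by move=> i _; rewrite mxE -expr2 sqr_ge0.
  move=> /allP xi0; apply/rowP => i; rewrite mxE.
  have /= := xi0 i (mem_index_enum _); rewrite mxE -expr2 sqrf_eq0.
  by move/eqP.
pose q : {poly R} := \det (\matrix_(i, j) ((i == j)%:R%:P * (1 - 'X) + (A i j)%:P * 'X)).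
have qE (s : R) : q.[s] = \det ((1 - s)%:M + s *: A).
  rewrite /q -horner_evalE -det_map_mx; congr (\det _).
  apply/matrixP => i j; rewrite !mxE.
  rewrite -[LHS]/((((i == j)%:R)%:P * (1 - 'X) + (A i j)%:P * 'X).[s]) !hornerE.
  by rewrite mulrC mulr_natr (mulrC _ s).
have q_neq0 (s : R) : 0 <= s <= 1 -> q.[s] != 0.
  move=> /andP[s0 s1]; rewrite qE -unitfE -unitmxE.
  rewrite -row_free_unit -kermx_eq0; apply/rowV0P => xi /sub_kermxP xi0.
  apply/eqP; apply: contraT => xin0; exfalso.
  have : (xi *m ((1 - s)%:M + s *: A) *m xi^T) 0 0 = 0 by rewrite xi0 mul0mx mxE.
  have -> : xi *m ((1 - s)%:M + s *: A) *m xi^T =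
      (1 - s) *: (xi *m xi^T) + s *: (xi *m A *m xi^T).
    by rewrite mulmxDr mulmxDl mul_mx_scalar -scalemxAr -!scalemxAl.
  rewrite mxE [X in X + _]mxE [X in _ + X]mxE => /eqP; rewrite gt_eqF//.
  have [s00|s00] := eqVneq s 0; first by rewrite s00 subr0 mul1r mul0r addr0 sq_gt0.
  have sp : 0 < s by rewrite lt_neqAle eq_sym s00.
  by rewrite ltr_wpDl ?mulr_gt0 ?Apos// mulr_ge0 ?subr_ge0// ltW// sq_gt0.
have q1 : q.[1] = \det A by rewrite qE subrr scale1r raddf0 add0r.
have q0 : q.[0] = 1 by rewrite qE subr0 scale0r addr0 det1.
rewrite -q1 lt_neqAle eq_sym q_neq0 ?ler01 ?lexx//= leNgt; apply/negP => q1neg.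
have [|s] := @poly_ivt R (- q) 0 1 ler01.
  by rewrite !hornerN q0 oppr_le0 ler01 oppr_ge0 ltW.
move=> sI; rewrite rootN => /rootP sr; have := q_neq0 s.
by move: sI; move=> -> /(_ isT); rewrite sr eqxx.
Qed.

Lemma metric_det_gt0 g x : riemannian_metric g -> 0 < \det (g x).
Proof. by move=> [_ /(_ x)[_ gp]]; exact: det_gt0. Qed.

Lemma vol_density_gt0 g x : riemannian_metric g -> 0 < vol_density g x.
Proof. by move=> gR; rewrite sqrtr_gt0 metric_det_gt0. Qed.

Lemma smooth_vol g : riemannian_metric g -> smooth (vol_density g).
Proof.
move=> gR; apply: smooth_sqrt; first by move=> x; exact: metric_det_gt0.
by apply: smooth_det; case: gR.
Qed.

Lemma smooth_laplace g f : riemannian_metric g -> smooth f ->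
  smooth (laplace_beltrami g f).
Proof.
move=> gR sf; apply: smoothM.
  apply: smoothV; first by move=> x; rewrite gt_eqF// vol_density_gt0.
  exact: smooth_vol.
apply: smooth_sum => j; apply: smooth_pd; apply: smoothM; first exact: smooth_vol.
apply: smooth_sum => k; apply: smoothM; last exact: smooth_pd.
apply: smooth_invmx; last by case: gR.
by move=> x; rewrite gt_eqF// metric_det_gt0.
Qed.

Lemma near_pd i f h x : (\forall y \near x, f y = h y) ->
  \forall y \near x, pd i f y = pd i h y.
Proof.
move=> /near_join; apply: filterS => y fh; exact: near_eq_derive.
Qed.

Lemma laplace_local g f h x : (\forall y \near x, f y = h y) ->
  laplace_beltrami g f x = laplace_beltrami g h x.
Proof.
move=> fh; rewrite /laplace_beltrami.
apply: (congr1 ( *%R (vol_density g x)^-1)); apply: eq_bigr => j _.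
apply: near_eq_derive.
have : \forall y \near x, forall k, pd k f y = pd k h y.
  apply: (@filter_forall V 'I_n (fun k y => pd k f y = pd k h y) (nbhs x) _) => k.
  exact: near_pd.
apply: filterS => y fhy; congr (_ * _); apply: eq_bigr => k _.
by rewrite fhy.
Qed.

Lemma laplace0 g x : laplace_beltrami g (fun=> 0) x = 0.
Proof.
rewrite /laplace_beltrami big1 ?mulr0// => j _.
rewrite (_ : (fun y => _) = cst 0); first exact: derive_cst.
apply/funext => y; rewrite big1 ?mulr0// => k _.
by rewrite /pd (_ : (fun=> 0) = cst 0)// derive_cst mulr0.
Qed.

Lemma laplace_supp g f x : laplace_beltrami g f x != 0 -> tsupp f x.
Proof.
apply: contra_neqP => nx; rewrite -[RHS](laplace0 g x).
by apply: laplace_local; exact: near_tsupp.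
Qed.

Lemma test_laplace g f : riemannian_metric g -> test_function f ->
  test_function (laplace_beltrami g f).
Proof.
move=> gR tf; apply: (test_function_sub _ tf); last exact: laplace_supp.
by case: tf => sf _; exact: smooth_laplace.
Qed.

End laplacian.

(** * Lebesgue measure of balls *)

Section tuple_measure.
Context {R : realType}.
Local Notation mR := (measurableTypeR R).
Local Notation mu n := (lebesgue_tuple R n).

Lemma rV_ofE n (t : n.-tuple mR) i : rV_of t 0 i = tnth t i.
Proof. by rewrite mxE. Qed.

(** The product sigma-algebra contains the boxes, and an open set is a countable
    union of boxes of a grid of mesh [1 / (k + 1)]. *)
Lemma measurable_rV_open n (U : set 'rV[R]_n) : open U ->
  measurable (@rV_of R n @^-1` U).
Proof.
move=> oU.
pose box (kz : nat * {ffun 'I_n -> int}) : set 'rV[R]_n :=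
  [set x | forall i, (kz.2 i)%:~R <= kz.1.+1%:R * x 0 i < (kz.2 i)%:~R + 1].
pose F kz : set (n.-tuple mR) :=
  if `[< box kz `<=` U >] then @rV_of R n @^-1` box kz else set0.
have -> : @rV_of R n @^-1` U = \bigcup_kz F kz.
  apply/seteqP; split=> [t Ut|t [kz _]]; last first.
    by rewrite /F; case: ifPn => // /asboolP; apply.
  have [e e0 eU] : exists2 e : R, 0 < e & forall y, `|rV_of t - y| < e -> U y.
    have := oU; rewrite openE => /(_ _ Ut); rewrite /interior/= => /nbhs_ballP[e/= e0 eU].
    by exists e => // y ty; apply: eU; rewrite mx_norm_ball.
  have [k ke] : exists k : nat, e^-1 < k.+1%:R.
    exists (Num.bound e^-1); apply: (lt_trans (archi_boundP _)); first by rewrite invr_ge0 ltW.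
    by rewrite ltr_nat.
  pose z := [ffun i : 'I_n => Num.floor (k.+1%:R * rV_of t 0 i)].
  have bU : box (k, z) `<=` U.
    move=> y yb; apply: eU; rewrite /Num.norm/= mx_normrE.
    apply/bigmax_ltP; split=> // -[i j] _ /=; rewrite ord1.
    have -> : (rV_of t - y) 0 j = rV_of t 0 j - y 0 j by rewrite !mxE.
    have := yb j; rewrite /z/= ffunE => /andP[y1 y2].
    have /andP[t1 t2] := floor_itv (k.+1%:R * rV_of t 0 j).
    have k0 : (0:R) < k.+1%:R by rewrite ltr0n.
    have : `|k.+1%:R * (rV_of t 0 j - y 0 j)| < 1.
      by rewrite ltr_norml mulrBr; move: t1 t2; rewrite intrD => t1 t2; apply/andP; split; lra.
    rewrite normrM (ger0_norm (ltW k0)) -ltr_pdivlMl// mulr1 => h; apply: (lt_trans h).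
    by rewrite invf_plt ?posrE.
  exists (k, z) => //; rewrite /F; case: ifPn => [_|/asboolPn//].
  move=> i; rewrite /z/= ffunE.
  by have := floor_itv (k.+1%:R * rV_of t 0 i); rewrite intrD.
apply: countable_bigcupT_measurable; first exact: countableP.
move=> -[k z]; rewrite /F; case: ifPn => // _.
have -> : @rV_of R n @^-1` box (k, z) =
    \bigcap_(i in [set: 'I_n]) ((fun t : n.-tuple mR => tnth t i : mR) @^-1`
      `[(z i)%:~R / k.+1%:R, ((z i)%:~R + 1) / k.+1%:R[).
  apply/seteqP; split=> t /= h i; have := h i; rewrite /= in_itv/= rV_ofE;
    rewrite ler_pdivrMr ?ltr0n// ltr_pdivlMr ?ltr0n// ![tnth t i * _]mulrC.
    by [].
  by apply.
apply: fin_bigcap_measurable; first exact: finite_finset.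
move=> i _; rewrite -[X in measurable X]setTI; apply: measurable_tnth => //.
Qed.

Lemma measurable_continuous_rV n (f : 'rV[R]_n -> R) : continuous f ->
  measurable_fun setT (fun t : n.-tuple mR => f (rV_of t)).
Proof.
move=> cf mD; apply: (measurability _ (measurable_realfun.RGenOInfty.measurableE R)) => //.
move=> _ [_ [x ->] <-]; rewrite setTI.
apply: (@measurable_rV_open n (f @^-1` `]x, +oo[%classic)).
by apply: open_comp => // y _; exact: cf.
Qed.

Definition eball n (r : R) : set (n.-tuple mR) := [set t | enorm (rV_of t) <= r].

Lemma measurable_eball n r : measurable (@eball n r).
Proof.
have -> : @eball n r = ~` (@rV_of R n @^-1` [set x | r < enorm x]).
  apply/seteqP; split=> t /=; rewrite /eball/=.
    by rewrite leNgt => /negP.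
  by move/negP; rewrite -leNgt.
apply: measurableC; apply: measurable_rV_open.
rewrite (_ : mkset _ = @enorm R n @^-1` [set z | r < z])//.
by apply: open_comp; [move=> x _; exact: continuous_enorm|exact: open_gt].
Qed.

Definition tcube n (r : R) : set (n.-tuple mR) :=
  [set t | forall i, `|tnth t i : R| <= r].

Lemma measurable_tcube n r : measurable (@tcube n r).
Proof.
have -> : @tcube n r =
    \bigcap_(i in [set: 'I_n]) ((fun t : n.-tuple mR => tnth t i : mR) @^-1` `[- r, r]).
  apply/seteqP; split=> t /= h i; have := h i; rewrite /= in_itv/= ler_norml//.
  by apply.
apply: fin_bigcap_measurable; first exact: finite_finset.
by move=> i _; rewrite -[X in measurable X]setTI; apply: measurable_tnth => //.
Qed.

Lemma tcube_finite n r : (mu n (@tcube n r) < +oo)%E.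
Proof.
elim: n => [|n IH].
  apply: (@le_lt_trans _ _ 1%E); last exact: ltry.
  rewrite -[X in (X <= _)%E]/(dirac ([tuple] : 0.-tuple mR) (@tcube 0 r)) diracE lee_fin.
  by case: (_ \in _).
rewrite -[X in (X < _)%E]/((lebesgue_measure \x mu n)%E (@tcons R n @^-1` @tcube n.+1 r)).
rewrite (_ : _ @^-1` _ = `[- r, r]%classic `*` @tcube n r).
  rewrite product_measure1E//; last exact: measurable_tcube.
  apply: lte_mul_pinfty => //.
  change (lebesgue_measure (`[- r, r]%classic : set mR) \is a fin_num).
  by rewrite lebesgue_measure_itv; case: ifP => _.
apply/seteqP; split=> -[a t] /=.
  move=> h; split; first by rewrite in_itv/= -ler_norml; have := h ord0; rewrite (tnth_nth 0).
  by move=> i; have := h (lift ord0 i); rewrite !(tnth_nth 0).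
move=> [+ h]; rewrite in_itv/= -ler_norml => ar i.
case: (unliftP ord0 i) => [j|] ->; last by rewrite (tnth_nth 0).
by have := h j; rewrite !(tnth_nth 0).
Qed.

Lemma eball_finite n r : (mu n (@eball n r) < +oo)%E.
Proof.
apply: le_lt_trans (tcube_finite n r); apply: le_measure; rewrite ?inE.
- exact: measurable_eball.
- exact: measurable_tcube.
- by move=> t /= tr i; rewrite -rV_ofE (le_trans (enorm_coord _ _)).
Qed.

Lemma lebesgue_measure_scale (s : R) (A : set mR) : 0 < s -> measurable A ->
  lebesgue_measure A = (s%:E * pushforward lebesgue_measure (fun a : mR => (s * a)%R : mR) A)%E.
Proof.
move=> s0 mA.
have ms : measurable_fun setT (fun a : mR => s * a : mR).
  exact: measurable_funM.
pose m1 : {measure set mR -> \bar R} :=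
  measure_function_pushforward__canonical__measure_function_Measure lebesgue_measure ms.
pose m2 : {measure set mR -> \bar R} := mscale (NngNum (ltW s0)) m1.
apply: (@lebesgue_measure_unique R m2) mA => _ [[a b]] _ <-.
rewrite /m2 /= /mscale /= /m1 /= /pushforward.
rewrite (_ : _ @^-1` _ = `]a / s, b / s]%classic); last first.
  by apply/seteqP; split=> x /=; rewrite !in_itv/= ltr_pdivrMr// ler_pdivlMr// mulrC.
rewrite !lebesgue_measure_itv/= !lte_fin ltr_pM2r ?invr_gt0//.
case: ifP => _; last by rewrite mule0.
by rewrite -!EFinB -EFinM -mulrBl mulrC divfK// gt_eqF.
Qed.

Lemma ge0_integral_scale (s : R) (f : mR -> \bar R) : 0 < s ->
  measurable_fun setT f -> (forall a, 0 <= f a)%E ->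
  (\int[lebesgue_measure]_a f (s * a)%R = (s^-1)%:E * \int[lebesgue_measure]_a f a)%E.
Proof.
move=> s0 mf f0.
have ms : measurable_fun setT (fun a : mR => s * a : mR).
  exact: measurable_funM.
pose m1 : {measure set mR -> \bar R} :=
  measure_function_pushforward__canonical__measure_function_Measure lebesgue_measure ms.
have -> : (\int[lebesgue_measure]_a f a = s%:E * \int[m1]_a f a)%E.
  rewrite -(@ge0_integral_mscale _ _ _ m1 setT measurableT (NngNum (ltW s0)) f)//.
  apply: eq_measure_integral => A mA _; exact: lebesgue_measure_scale.
rewrite muleA -EFinM mulVf ?gt_eqF// mul1e.
by rewrite ge0_integral_pushforward.
Qed.

Definition dilate n (s : R) (t : n.-tuple mR) : n.-tuple mR :=
  [tuple s * tnth t i | i < n].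

Lemma dilate_tcons n s a (t : n.-tuple mR) :
  dilate s (tcons (a, t)) = tcons (s * a, dilate s t).
Proof.
apply: eq_from_tnth => i; rewrite tnth_mktuple.
case: (unliftP ord0 i) => [j|] ->; rewrite !(tnth_nth 0)//=.
rewrite add0n -tnth_nth; have := tnth_mktuple (fun i => s * tnth t i) j.
by rewrite [X in X = _](tnth_nth 0) /= => ->.
Qed.

(** Fubini reduces the scaling law to dimension one; it stands in for polar
    coordinates, since it gives the exact dependence of the volume of a ball on its
    radius. *)
Lemma lebesgue_tuple_dilate n (s : R) (A : set (n.-tuple mR)) : 0 < s ->
  measurable A -> mu n (@dilate n s @^-1` A) = ((s ^- n)%:E * mu n A)%E.
Proof.
move=> s0; elim: n A => [|n IH] A mA.
  rewrite expr0 invr1 mul1e; congr (mu 0 _).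
  by apply/seteqP; split=> t /=; rewrite (tuple0 (dilate s t)) (tuple0 t).
have mtA : measurable (@tcons R n @^-1` A).
  by rewrite -[X in measurable X]setTI; apply: measurable_tcons.
rewrite -[LHS]/(\int[lebesgue_measure]_a (mu n
  (xsection (@tcons R n @^-1` (@dilate n.+1 s @^-1` A)) a)))%E.
have xs (a : mR) : xsection (@tcons R n @^-1` (@dilate n.+1 s @^-1` A)) a =
    @dilate n s @^-1` (xsection (@tcons R n @^-1` A) (s * a)).
  apply/seteqP; split=> t /=.
    by rewrite /xsection/= !inE/= dilate_tcons.
  by rewrite /xsection/= !inE/= dilate_tcons.
under eq_integral => a _.
  rewrite xs IH; last exact: measurable_xsection.
  over.
rewrite /= ge0_integralZl//; last 2 first.
- apply: (@measurableT_comp _ _ _ _ _ _ (fun a => mu n (xsection (@tcons R n @^-1` A) a)) setT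
    (fun a : mR => s * a : mR)); last exact: measurable_funM.
  exact: measurable_fun_xsection.
- by rewrite lee_fin invr_ge0 exprn_ge0// ltW.
rewrite (@ge0_integral_scale s (fun a => mu n (xsection (@tcons R n @^-1` A) a)))//; last first.
  exact: measurable_fun_xsection.
by rewrite muleA -EFinM -invfM -exprSr.
Qed.

End tuple_measure.

(** * Integrals over balls *)

Section ball_integrals.
Context {R : realType} {n : nat}.
Local Notation mR := (measurableTypeR R).
Local Notation mu := (lebesgue_tuple R n).
Implicit Types (f h w : 'rV[R]_n -> R) (r : R).

Lemma enormZ (s : R) (x : 'rV[R]_n) : 0 <= s -> enorm (s *: x) = s * enorm x.
Proof.
move=> s0; rewrite /enorm.
have -> : \sum_i (s *: x) 0 i ^+ 2 = s ^+ 2 * \sum_i x 0 i ^+ 2.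
  by rewrite mulr_sumr; apply: eq_bigr => i _; rewrite mxE exprMn.
by rewrite sqrtrM ?sqr_ge0// sqrtr_sqr ger0_norm.
Qed.

Lemma eball_volume r : 0 < r ->
  mu (@eball R n r) = (r ^+ n * fine (mu (@eball R n 1)))%:E.
Proof.
move=> r0.
have -> : @eball R n r = @dilate R n r^-1 @^-1` @eball R n 1.
  apply/seteqP; split=> t; rewrite /eball/=.
    have -> : rV_of (dilate r^-1 t) = r^-1 *: rV_of t.
      by apply/rowP => i; rewrite [RHS]mxE !rV_ofE tnth_mktuple.
    by rewrite enormZ ?invr_ge0 ?(ltW r0)// ler_pdivrMl// mulr1.
  have -> : rV_of (dilate r^-1 t) = r^-1 *: rV_of t.
    by apply/rowP => i; rewrite [RHS]mxE !rV_ofE tnth_mktuple.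
  by rewrite enormZ ?invr_ge0 ?(ltW r0)// ler_pdivrMl// mulr1.
rewrite lebesgue_tuple_dilate ?invr_gt0//; last exact: measurable_eball.
rewrite exprVn invrK EFinM fineK// ge0_fin_numE//; exact: eball_finite.
Qed.

Lemma enorm_rV_measurable : measurable_fun setT (fun t : n.-tuple mR => enorm (rV_of t)).
Proof. exact: (measurable_continuous_rV (@continuous_enorm R n)). Qed.

Lemma eball_sub r r' : r <= r' -> @eball R n r `<=` @eball R n r'.
Proof. by move=> rr t /= tr; exact: le_trans rr. Qed.

Lemma exp_weight_measurable (a r : R) (D : set (n.-tuple mR)) :
  measurable_fun D (fun t => (expR (- a * (r - enorm (rV_of t))))%:E).
Proof.
apply/measurable_EFinP; apply: measurable_funTS.
apply: (@measurableT_comp _ _ _ _ _ _ (@expR R)); first exact: measurable_expR.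
apply: measurable_funM => //; apply: measurable_funB => //.
exact: enorm_rV_measurable.
Qed.

Lemma exprn_increment (m : nat) r : 1 <= r ->
  r ^+ m.+1 - (r - 1) ^+ m.+1 <= m.+1%:R * r ^+ m.
Proof.
move=> r1; have r10 : 0 <= r - 1 by rewrite subr_ge0.
have r0 : 0 <= r by rewrite (le_trans _ r1).
rewrite subrXX opprB addrC subrK mul1r.
rewrite (@le_trans _ _ (\sum_(i < m.+1) r ^+ m))//; last first.
  by rewrite sumr_const card_ord mulr_natl.
apply: ler_sum => i _;
have -> : r ^+ m = r ^+ (m - i) * r ^+ i by rewrite -exprD subnK// -ltnS.
rewrite ler_wpM2l ?exprn_ge0//; apply: lerXn2r; rewrite ?nnegrE//.
by rewrite gerBl.
Qed.

(** Increasing the radius from [r - 1] to [r] multiplies the integral by [exp (- a)]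
    and adds at most the volume of a shell, of order [r^(n - 1)]: a contraction with
    a forcing term, whose solution is of the order of the forcing. *)
Lemma exp_ball (a : R) : (0 < n)%N -> 0 < a -> exists2 D : R, 0 < D &
  forall r, 0 <= r ->
  (\int[mu]_(t in @eball R n r) (expR (- a * (r - enorm (rV_of t))))%:E
    <= (D * (1 + r) ^+ n.-1)%:E)%E.
Proof.
move=> n0 a0; pose om : R := fine (mu (@eball R n 1)).
have om0 : 0 <= om by rewrite fine_ge0.
have e1 : 0 < 1 - expR (- a) by rewrite subr_gt0 expR_lt1 oppr_lt0.
(* [D] is a fixed point of [D = exp (- a) D + n om], with 1 added for positivity. *)
pose D := (om * n%:R + 1) / (1 - expR (- a)).
have D0 : 0 < D by rewrite divr_gt0// ltr_wpDl// mulr_ge0.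
have omD : om <= D.
  rewrite ler_pdivlMr// (@le_trans _ _ om)//.
    by rewrite ler_piMr// gerBl expR_ge0.
  by rewrite (@le_trans _ _ (om * n%:R)) ?lerDl// ler_peMr// ler1n.
have DE : expR (- a) * D + om * n%:R <= D.
  have DD : D = expR (- a) * D + (om * n%:R + 1).
    by rewrite /D; field; rewrite gt_eqF.
  by rewrite [leRHS]DD lerD2l lerDl.
exists D => //.
suff main : forall (N : nat) r, 0 <= r <= N.+1%:R ->
    (\int[mu]_(t in @eball R n r) (expR (- a * (r - enorm (rV_of t))))%:E
    <= (D * (1 + r) ^+ n.-1)%:E)%E.
  move=> r r0; apply: (main (Num.bound r)); rewrite r0 ltW//.
  by rewrite (lt_trans (archi_boundP r0))// ltr_nat.
have exp_le1 r t : @eball R n r t -> expR (- a * (r - enorm (rV_of t))) <= 1.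
  by move=> /= tr; rewrite expR_le1 mulNr oppr_le0 mulr_ge0 ?subr_ge0 ?(ltW a0).
elim=> [|N IH] r /andP[r0 rN].
  apply: (@le_trans _ _ (\int[mu]_(t in @eball R n r) (cst 1%:E t))%E).
    apply: ge0_le_integral => //; first exact: measurable_eball.
    - exact: exp_weight_measurable.
    - by move=> t tr; rewrite lee_fin; exact: exp_le1.
  rewrite integral_cst; last exact: measurable_eball.
  rewrite mul1e (@le_trans _ _ (mu (@eball R n 1)))//.
    by apply: le_measure; rewrite ?inE; [exact: measurable_eball..|exact: eball_sub].
  rewrite -[leLHS]fineK; last by rewrite ge0_fin_numE//; exact: eball_finite.
  rewrite lee_fin (le_trans omD)// ler_peMr ?(ltW D0)// exprn_ege1// lerDl//.
have [r1|r1] := leP r 1; first by apply: IH; rewrite r0 (le_trans r1)// ler1n.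
have r10 : 0 < r - 1 by rewrite subr_gt0.
have [m nE] : exists m, n = m.+1 by exists n.-1; rewrite prednK.
set f := fun t : n.-tuple mR => (expR (- a * (r - enorm (rV_of t))))%:E.
have f0 t : (0 <= f t)%E by rewrite lee_fin expR_ge0.
have -> : @eball R n r = @eball R n (r - 1) `|` (@eball R n r `\` @eball R n (r - 1)).
  by rewrite setDUK//; apply: eball_sub; rewrite gerBl.
have mshell : measurable (@eball R n r `\` @eball R n (r - 1)).
  by apply: measurableD; exact: measurable_eball.
rewrite ge0_integral_setU//; last 3 first.
- exact: measurable_eball.
- exact: exp_weight_measurable.
- by apply/disj_setPS => t [/= t1 [_]].
have inner : (\int[mu]_(t in @eball R n (r - 1)) f t <=
    (expR (- a) * (D * r ^+ n.-1))%:E)%E.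
  have -> : (\int[mu]_(t in @eball R n (r - 1)) f t = (expR (- a))%:E *
      \int[mu]_(t in @eball R n (r - 1)) (expR (- a * (r - 1 - enorm (rV_of t))))%:E)%E.
    rewrite -ge0_integralZl//; last 2 first.
    - exact: measurable_eball.
    - exact: exp_weight_measurable.
    apply: eq_integral => t _; rewrite /f -EFinM -expRD; congr (expR _)%:E; ring.
  rewrite EFinM lee_wpmul2l ?lee_fin ?expR_ge0//.
  have := IH (r - 1); rewrite (addrC 1) subrK; apply.
  by rewrite (ltW r10)/= lerBlDr natr1.
have outer : (\int[mu]_(t in @eball R n r `\` @eball R n (r - 1)) f t <=
    (om * (n%:R * r ^+ n.-1))%:E)%E.
  apply: (@le_trans _ _ (\int[mu]_(t in @eball R n r `\` @eball R n (r - 1)) (cst 1%:E t))%E).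
    apply: ge0_le_integral => //.
    - exact: exp_weight_measurable.
    - by move=> t [tr _]; rewrite lee_fin; exact: exp_le1.
  rewrite integral_cst// mul1e measureD//; [|exact: measurable_eball..|exact: eball_finite].
  rewrite (_ : @eball R n r `&` _ = @eball R n (r - 1)); last first.
    by apply/setIidPr; apply: eball_sub; rewrite gerBl.
  change (mu (@eball R n r) - mu (@eball R n (r - 1)) <= (om * (n%:R * r ^+ n.-1))%:E)%E.
  rewrite (eball_volume (lt_trans ltr01 r1)).
  rewrite (eball_volume r10) -EFinB lee_fin -/om -mulrBl mulrC.
  rewrite ler_wpM2l// nE /=; exact: (exprn_increment _ (ltW r1)).
apply: (le_trans (leeD inner outer)); rewrite -EFinD lee_fin.
rewrite (@le_trans _ _ (D * r ^+ n.-1))//.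
  by rewrite mulrA [om * (_ * _)]mulrA -mulrDl ler_wpM2r// exprn_ge0.
rewrite ler_wpM2l ?(ltW D0)//; apply: lerXn2r; rewrite ?nnegrE ?addr_ge0//.
by rewrite lerDr.
Qed.

Lemma integrable_mul_cpt w f r : loc_integrable w -> continuous f ->
  (forall x, r < enorm x -> f x = 0) ->
  mu.-integrable setT (fun t => (w (rV_of t) * f (rV_of t))%:E).
Proof.
move=> wl cf f0.
have wA : mu.-integrable (@eball R n r) (fun t => (w (rV_of t))%:E).
  exact: (wl _ (@compact_enorm_le R n r)).
have mb := @measurable_eball R n r.
have : mu.-integrable (@eball R n r) (fun t => (w (rV_of t) * f (rV_of t))%:E).
  have [M [_ Mf]] : bounded_set (f @` [set x | enorm x <= r]).
    apply: compact_bounded; apply: continuous_compact; last exact: compact_enorm_le.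
    exact: continuous_subspaceT.
  have M1 : forall x, enorm x <= r -> `|f x| <= `|M| + 1.
    move=> x xr; apply: (Mf (`|M| + 1)); last by exists x.
    by rewrite (le_lt_trans (ler_norm M))// ltrDl.
  apply: (@le_integrable _ _ _ _ _ mb _ (fun t => ((`|M| + 1) * w (rV_of t))%:E)).
  - apply/measurable_EFinP; apply: measurable_funM.
      by apply/measurable_EFinP; case/integrableP: wA.
    by apply: measurable_funTS; exact: measurable_continuous_rV.
  - move=> t tr; rewrite lee_fin !normrM [X in _ <= X * _]ger0_norm ?addr_ge0//.
    by rewrite mulrC ler_wpM2r// M1.
    exact: (integrableZl mb (`|M| + 1) wA).
move/(integrable_mkcond _ mb); apply: eq_integrable => // t _.
rewrite patchE; case: ifPn => // /negP; rewrite inE /eball/= => /negP; rewrite -ltNge => tr.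
by rewrite f0// mulr0.
Qed.

Lemma loc_integrable_cst (a : R) : loc_integrable (fun _ : 'rV[R]_n => a).
Proof.
move=> A cA; have mA : measurable (@rV_of R n @^-1` A).
  have -> : @rV_of R n @^-1` A = ~` (@rV_of R n @^-1` (~` A)).
    by apply/seteqP; split=> t /=; [move=> At; apply|move/contrapT].
  apply: measurableC; apply: measurable_rV_open.
  by apply: closed_openC; exact: (@compact_closed _ A (@norm_hausdorff R 'rV[R]_n) cA).
apply: (@measurable_bounded_integrable _ _ _ _ (fun=> a)) => //.
  have [M [_ Mf]] : bounded_set (@enorm R n @` A).
    apply: compact_bounded; apply: continuous_compact cA.
    by apply: continuous_subspaceT; exact: continuous_enorm.
  apply: (@le_lt_trans _ _ (mu (@eball R n (`|M| + 1)))); last exact: eball_finite.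
  apply: le_measure; rewrite ?inE//; first exact: measurable_eball.
  move=> t At; rewrite /eball/= -[leLHS]ger0_norm ?enorm_ge0//.
  apply: (Mf (`|M| + 1)); last by exists (rV_of t).
  by rewrite (le_lt_trans (ler_norm M))// ltrDl.
by exists `|a|; split => // x ax t _ /=; rewrite ltW.
Qed.

End ball_integrals.

(** * The radial distance *)

Section radial_function.
Context {R : realType}.
Implicit Types (K : R -> R) (a b d r : R).

Lemma radial_integrable K d b : 0 < d ->
  (forall r, 0 < r -> derivable K r 1) -> (forall r, 0 < r -> d < K r < d^-1) ->
  lebesgue_measure.-integrable `[0, b] (EFin \o K).
Proof.
move=> d0 dK Kd.
have mK : measurable_fun `[0, b] K.
  apply/measurable_fun_itv_obnd_cbndP.
  have mK : measurable_fun (`]0, +oo[ : set R) K.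
    apply: open_continuous_measurable_fun => // r /[!inE]/=; rewrite in_itv/= andbT => r0.
    by apply/differentiable_continuous/derivable1_diffP; exact: dK.
  apply: measurable_funS mK => // r /=; rewrite !in_itv/= andbT.
  by case/andP.
apply: measurable_bounded_integrable => //.
  by rewrite /= lebesgue_measure_itv; case: ifP => _; exact: ltry.
exists (`|K 0| + d^-1); split; first exact: num_real.
move=> M hM r /=; rewrite in_itv/= => /andP[r0 _]; apply: le_trans (ltW hM).
move: r0; rewrite le_eqVlt => /predU1P[<-|r0]; first by rewrite lerDl invr_ge0 ltW.
have /andP[Kl Kr] := Kd r r0.
by rewrite ger0_norm ?(ltW (lt_trans d0 Kl))// ler_wpDl ?(ltW Kr).
Qed.

Lemma radial_increment K d a b : 0 < d ->
  (forall r, 0 < r -> derivable K r 1) -> (forall r, 0 < r -> d < K r < d^-1) ->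
  0 <= a -> a <= b -> d * (b - a) <= radial K b - radial K a <= d^-1 * (b - a).
Proof.
move=> d0 dK Kd a0 ab.
have iK := @radial_integrable K d b d0 dK Kd.
rewrite /radial Rintegral_itvB//.
have iab : lebesgue_measure.-integrable `]a, b] (EFin \o K).
  apply: integrableS iK => // r /=; rewrite !in_itv/= => /andP[ar ->].
  by rewrite andbT (le_trans a0) ?ltW.
have ic (k : R) : lebesgue_measure.-integrable `]a, b] (EFin \o (fun=> k)).
  apply: measurable_bounded_integrable => //.
    by rewrite /= lebesgue_measure_itv; case: ifP => _; exact: ltry.
  by exists `|k|; split => // M hM r _ /=; rewrite ltW.
have ci (k : R) : \int[lebesgue_measure]_(x in `]a, b]) k = k * (b - a).
  rewrite Rintegral_cst//= lebesgue_measure_itv/= lte_fin.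
  move: ab; rewrite le_eqVlt => /predU1P[->|ab]; first by rewrite ltxx subrr.
  by rewrite ab.
rewrite -(ci d) -(ci d^-1); apply/andP; split; apply: le_Rintegral => // r /=;
  rewrite in_itv/= => /andP[ar _]; have /andP[? ?] := Kd r (le_lt_trans a0 ar);
  exact: ltW.
Qed.

Lemma radial0 K : radial K 0 = 0.
Proof. by rewrite /radial set_itv1 Rintegral_set1. Qed.

Lemma radial_level K d rho : 0 < d ->
  (forall r, 0 < r -> derivable K r 1) -> (forall r, 0 < r -> d < K r < d^-1) ->
  0 <= rho -> exists2 r, 0 <= r & radial K r = rho.
Proof.
move=> d0 dK Kd rho0; have inc a b := @radial_increment K d a b d0 dK Kd.
have b0 : 0 <= rho / d by rewrite divr_ge0// ltW.
have [r rI rE] : exists2 r, r \in `[0, rho / d] & radial K r = rho.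
  apply: IVT => //.
    apply/subspace_continuousP => y /=; rewrite in_itv/= => /andP[y0 _].
    apply/cvgrPdist_le => e e0; rewrite near_withinE; near=> z.
    move=> /=; rewrite in_itv/= => /andP[z0 _].
    have yz : `|y - z| <= d * e.
      by near: z; apply: cvgr_dist_le; [exact: cvg_id|rewrite mulr_gt0].
    rewrite (@le_trans _ _ (d^-1 * `|y - z|))//; last by rewrite ler_pdivrMl.
    have [yz'|yz'] := leP y z.
      have /andP[h1 h2] := inc _ _ y0 yz'.
      rewrite distrC [X in _ <= _ * X]distrC !ger0_norm ?subr_ge0//.
      by rewrite -subr_ge0 (le_trans _ h1)// mulr_ge0 ?subr_ge0// ltW.
    have /andP[h1 h2] := inc _ _ z0 (ltW yz').
    rewrite !ger0_norm ?subr_ge0 ?(ltW yz')//.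
    by rewrite -subr_ge0 (le_trans _ h1)// mulr_ge0 ?subr_ge0// ltW.
  rewrite radial0; have /andP[+ _] := inc 0 (rho / d) (lexx _) b0.
  rewrite radial0 !subr0 mulrC divfK ?gt_eqF// => h.
  by rewrite ge_min rho0/= le_max h orbT.
by exists r => //; move: rI; rewrite in_itv/= => /andP[].
Unshelve. all: by end_near. Qed.

End radial_function.

(** * Integration against the Riemannian volume *)

Section volume_integrals.
Context {R : realType} {n : nat} (g : 'rV[R]_n -> 'M[R]_n).
Context (gR : riemannian_metric g).
Local Notation mu := (lebesgue_tuple R n).
Implicit Types (f h w W : 'rV[R]_n -> R) (r q M : R).

Lemma vol_continuous : continuous (vol_density g).
Proof. exact: (smooth_continuous (smooth_vol gR)). Qed.

Lemma vol_ge0 x : 0 <= vol_density g x.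
Proof. exact: sqrtr_ge0. Qed.

Lemma vint_integrable w f r : loc_integrable w -> continuous f ->
  (forall x, r < enorm x -> f x = 0) ->
  mu.-integrable setT (EFin \o (fun t => w (rV_of t) * f (rV_of t) * vol_density g (rV_of t))).
Proof.
move=> wl cf f0.
have cfv : continuous (fun x => f x * vol_density g x).
  by move=> x; exact: (cvgM (cf x) (@vol_continuous x)).
have f0v x : r < enorm x -> f x * vol_density g x = 0.
  by move=> xr; rewrite f0// mul0r.
have := integrable_mul_cpt wl cfv f0v.
by apply: eq_integrable => // t _; rewrite mulrA.
Qed.

Lemma vintZ (a : R) w f r : loc_integrable w -> continuous f ->
  (forall x, r < enorm x -> f x = 0) ->
  vint g (fun x => a * (w x * f x)) = a * vint g (fun x => w x * f x).
Proof.
move=> wl cf f0; rewrite /vint -RintegralZl//; last exact: vint_integrable f0.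
by apply: eq_Rintegral => t _; rewrite !mulrA.
Qed.

Lemma vintD w1 f1 w2 f2 r : loc_integrable w1 -> continuous f1 ->
  loc_integrable w2 -> continuous f2 ->
  (forall x, r < enorm x -> f1 x = 0) -> (forall x, r < enorm x -> f2 x = 0) ->
  vint g (fun x => w1 x * f1 x + w2 x * f2 x) =
  vint g (fun x => w1 x * f1 x) + vint g (fun x => w2 x * f2 x).
Proof.
move=> w1l cf1 w2l cf2 f10 f20; rewrite /vint -RintegralD//; last 2 first.
- exact: vint_integrable f10.
- exact: vint_integrable f20.
by apply: eq_Rintegral => t _; rewrite mulrDl.
Qed.

Lemma vint_le w1 f1 w2 f2 r : loc_integrable w1 -> continuous f1 ->
  loc_integrable w2 -> continuous f2 ->
  (forall x, r < enorm x -> f1 x = 0) -> (forall x, r < enorm x -> f2 x = 0) ->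
  (forall x, w1 x * f1 x <= w2 x * f2 x) ->
  vint g (fun x => w1 x * f1 x) <= vint g (fun x => w2 x * f2 x).
Proof.
move=> w1l cf1 w2l cf2 f10 f20 le12; apply: le_Rintegral => //.
- exact: vint_integrable f10.
- exact: vint_integrable f20.
- by move=> t _; rewrite ler_wpM2r ?vol_ge0.
Qed.

Lemma vint_ge0 f : (forall x, 0 <= f x) -> 0 <= vint g f.
Proof. by move=> f0; apply: Rintegral_ge0 => t _; rewrite mulr_ge0 ?vol_ge0. Qed.

(** The graph of [a |-> a^q] lies above its tangent at [b]; this is Young's
    inequality for [a] and [b^(q - 1)]. *)
Lemma power_tangent (a b q : R) : 0 <= a -> 0 <= b -> 1 < q ->
  q * b `^ (q - 1) * a <= a `^ q + (q - 1) * b `^ q.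
Proof.
move=> a0 b0 q1; have q0 : 0 < q by exact: lt_trans q1.
have q10 : 0 < q - 1 by rewrite subr_gt0.
have := @conjugate_powR R a (b `^ (q - 1)) q (q / (q - 1)) a0 (powR_ge0 _ _) q0
  (divr_gt0 q0 q10).
have -> : q^-1 + (q / (q - 1))^-1 = 1 by field; rewrite !gt_eqF.
move=> /(_ erefl); rewrite -powRrM.
have -> : (q - 1) * (q / (q - 1)) = q by field; rewrite gt_eqF.
move=> h; have := ler_wpM2l (ltW q0) h.
have -> : q * (a `^ q / q + b `^ q / (q / (q - 1))) = a `^ q + (q - 1) * b `^ q.
  by field; rewrite !gt_eqF.
by rewrite [a * _]mulrC mulrA.
Qed.

(** Jensen's inequality for the measure of density [W], whose mass is only known
    to be at most [M]: integrate the tangent line of [a |-> a^q] at the mean. *)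
Lemma vint_jensen q w W r M : 1 < q -> 0 < M ->
  loc_integrable w -> loc_integrable (fun x => `|w x| `^ q) ->
  continuous W -> (forall x, 0 <= W x) -> (forall x, r < enorm x -> W x = 0) ->
  vint g W <= M ->
  `|vint g (fun x => w x * W x)| `^ q * M `^ (- (q - 1)) <=
  vint g (fun x => `|w x| `^ q * W x).
Proof.
move=> q1 M0 wl wql cW W0 Wr WM.
have q0 : 0 < q by exact: lt_trans q1.
have nwl : loc_integrable (fun x => `|w x|).
  move=> A cA; have := wl A cA => iw; exact: (integrable_norm iw).
set J := vint g (fun x => `|w x| * W x).
have J0 : 0 <= J by apply: vint_ge0 => x; rewrite mulr_ge0.
have IJ : `|vint g (fun x => w x * W x)| <= J.
  apply: (le_trans (le_normr_Rintegral measurableT (vint_integrable wl cW Wr))).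
  rewrite le_eqVlt; apply/orP; left; apply/eqP; apply: eq_Rintegral => t _ /=.
  by rewrite !normrM (ger0_norm (W0 _)) (ger0_norm (vol_ge0 _)).
set th := J / M; have th0 : 0 <= th by rewrite divr_ge0// ltW.
have l1 := loc_integrable_cst (n := n) (1 : R).
have c1 (a : R) := loc_integrable_cst (n := n) a.
have tangent : vint g (fun x => (q * th `^ (q - 1)) * (`|w x| * W x)) <=
    vint g (fun x => `|w x| `^ q * W x + (q - 1) * th `^ q * W x).
  rewrite (_ : (fun x => (q * th `^ (q - 1)) * (`|w x| * W x)) =
    (fun x => `|w x| * ((q * th `^ (q - 1)) * W x))); last first.
    by apply/funext => x; rewrite mulrCA.
  apply: le_Rintegral => //.
  - apply: (@vint_integrable (fun x => `|w x|) (fun x => (q * th `^ (q - 1)) * W x) r nwl).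
      by move=> x; exact: (cvgM (cvg_cst _) (cW x)).
    by move=> x xr; rewrite Wr// mulr0.
  - have iA := vint_integrable wql cW Wr.
    have iB := vint_integrable (c1 ((q - 1) * th `^ q)) cW Wr.
    have := integrableD measurableT iA iB.
    by apply: eq_integrable => // t _; rewrite /= -EFinD -mulrDl.
  - move=> t _; rewrite ler_wpM2r ?vol_ge0// mulrCA mulrA -mulrDl ler_wpM2r//.
    exact: power_tangent.
have h1 : vint g (fun x => (q * th `^ (q - 1)) * (`|w x| * W x)) = q * th `^ (q - 1) * J.
  exact: (vintZ _ nwl cW Wr).
have h2 : vint g (fun x => `|w x| `^ q * W x + (q - 1) * th `^ q * W x) <=
    vint g (fun x => `|w x| `^ q * W x) + (q - 1) * th `^ q * M.
  rewrite (vintD wql cW (c1 _) cW Wr Wr) lerD2l.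
  have -> : vint g (fun x => (q - 1) * th `^ q * W x) = (q - 1) * th `^ q * vint g W.
    have := vintZ ((q - 1) * th `^ q) l1 cW Wr.
    rewrite (_ : (fun x => _ * (1 * W x)) = fun x => (q - 1) * th `^ q * W x); last first.
      by apply/funext => x; rewrite mul1r.
    move=> ->; congr (_ * vint g _); apply/funext => x; exact: mul1r.
  by rewrite ler_wpM2l// mulr_ge0 ?powR_ge0// subr_ge0 ltW.
have key : th `^ (q - 1) * J <= vint g (fun x => `|w x| `^ q * W x).
  rewrite h1 in tangent; have := le_trans tangent h2.
  have -> : (q - 1) * th `^ q * M = (q - 1) * (th `^ (q - 1) * J).
    rewrite -(@mulr_powRB1 _ th q)//.
    have -> : J = th * M by rewrite /th divfK// gt_eqF.
    ring.
  lra.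
apply: le_trans key.
rewrite (@le_trans _ _ (J `^ q * M `^ (- (q - 1))))//.
  rewrite ler_wpM2r ?powR_ge0//; apply: ge0_ler_powR; rewrite ?nnegrE//; exact: ltW.
rewrite powRN /th (@powRM _ J) ?invr_ge0 ?(ltW M0)// -(@mulr_powRB1 _ J q)//.
have -> : M^-1 `^ (q - 1) = (M `^ (q - 1))^-1.
  by rewrite -powR_inv1 ?(ltW M0)// powRAC powR_inv1 ?powR_ge0.
by rewrite le_eqVlt; apply/orP; left; apply/eqP; ring.
Qed.

End volume_integrals.

(** * Growth of the eigenfunction *)

Section geometry.
Context {R : realType} {n : nat} (g : 'rV[R]_n -> 'M[R]_n) (K : R -> R).
Context (ae : asymptotically_euclidean g K).
Local Notation mu := (lebesgue_tuple R n).

Lemma ae_riemannian : riemannian_metric g. Proof. by case: ae. Qed.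

Lemma ae_radial : exists2 d : R, 0 < d <= 1 &
  (forall r : R, 0 < r -> derivable K r 1) /\ (forall r : R, 0 < r -> d < K r < d^-1).
Proof.
case: ae => _ [g2 [_ [dK _] _ [d [/andP[d0 d1] _ Kd]]]].
exists d; first by rewrite d0 ltW.
by split => // r /dK[].
Qed.

Lemma radial_ge0 r : 0 <= r -> 0 <= radial K r.
Proof.
move=> r0; have [d /andP[d0 _] [dK Kd]] := ae_radial.
have /andP[+ _] := radial_increment d0 dK Kd (lexx 0) r0.
by rewrite radial0 !subr0; apply: le_trans; rewrite mulr_ge0// ltW.
Qed.

Lemma enorm_gt0 (x : 'rV[R]_n) : x != 0 -> 0 < enorm x.
Proof.
move=> x0; rewrite lt_neqAle enorm_ge0 andbT eq_sym.
apply: contra_neq x0 => x0; apply/rowP => i; rewrite mxE.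
by apply/eqP; rewrite -normr_le0 -x0 enorm_coord.
Qed.

(** The decomposition of [g] is given off the origin, where the radial part has
    bounded entries because [K] and the direction cosines are bounded, and the
    remainder even decays. *)
Lemma metric_bounded : exists2 B : R, 0 <= B &
  forall x i j, x != 0 -> `|g x i j| <= B.
Proof.
have [d /andP[d0 _] [dK Kd]] := ae_radial.
case: ae => _ [g2 [gE _ [_ [be [C [be0 C0 g2C]]]] _]].
exists (1 + (d^-1 ^+ 2 + 1) + C).
  by rewrite !addr_ge0 ?sqr_ge0// ltW.
move=> x i j x0; have r0 := enorm_gt0 x0; rewrite gE// mxE.
apply: (le_trans (ler_normD _ _)); apply: lerD; last first.
  have [h _] := g2C x i j x0.
  rewrite (@le_trans _ _ (enorm (gradient (fun y => g2 y i j) x) + `|g2 x i j|))//.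
    by rewrite lerDr enorm_ge0.
  rewrite (le_trans h)// ler_piMr ?(ltW C0)// expR_le1 mulNr oppr_le0.
  by rewrite mulr_ge0 ?(ltW be0)// radial_ge0// ltW.
rewrite mxE; apply: (le_trans (ler_normD _ _)); apply: lerD.
  by case: (i == j); rewrite ?normr1 ?normr0.
have coord k : `|x 0 k / enorm x| <= 1.
  by rewrite normrM normfV (ger0_norm (ltW r0)) ler_pdivrMr// mul1r enorm_coord.
rewrite -mulrA normrM -[leRHS]mulr1.
have K0 : 0 <= K (enorm x) by have /andP[/(lt_trans d0)/ltW] := Kd _ r0.
have Kle : K (enorm x) <= d^-1 by have /andP[_ /ltW] := Kd _ r0.
apply: ler_pM => //.
  apply: (le_trans (ler_normB _ _)); rewrite normr1 lerD2r normrX (ger0_norm K0).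
  by apply: lerXn2r; rewrite ?nnegrE// invr_ge0 ltW.
by rewrite normrM -[leRHS]mulr1; apply: ler_pM.
Qed.

Lemma vol_bounded : exists2 B : R, 0 < B & forall x, vol_density g x <= B.
Proof.
have [B B0 gB] := metric_bounded.
pose b := Num.sqrt (\sum_(s : 'S_n) B ^+ n).
exists (1 + b + vol_density g 0).
  by rewrite -addrA ltr_pwDl// addr_ge0 ?sqrtr_ge0// vol_ge0.
move=> x; have [->|x0] := eqVneq x 0.
  by rewrite lerDr addr_ge0// sqrtr_ge0.
rewrite (@le_trans _ _ b)//; last first.
  by rewrite -addrA addrCA lerDl addr_ge0// vol_ge0.
rewrite ler_sqrt; last by rewrite sumr_ge0// => s _; rewrite exprn_ge0.
apply: (le_trans (ler_norm _)); apply: (le_trans (ler_norm_sum _ _ _)).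
apply: ler_sum => s _; rewrite normrM normrX normrN1 expr1n mul1r normr_prod.
rewrite (@le_trans _ _ (\prod_(i < n) B))//; last by rewrite prodr_const card_ord.
by apply: ler_prod => i _; rewrite normr_ge0 gB.
Qed.

(** Going inwards from the sphere of radius [r], the exponential in the bound on [phi]
    decays at least at the rate [lambda d], while [(1 + |x|)^(- m)] exceeds
    [(1 + r)^(- m)] at most by the factor [(1 + r - |x|)^m]. Half of the exponential
    decay absorbs this factor. *)
Lemma phi_layer (lambda c0 m : R) (phi : 'rV[R]_n -> R) : 0 < m ->
  m = (n%:R - 1) / 2 -> 0 < lambda -> 0 < c0 ->
  phi_lambda g K lambda c0 phi ->
  exists a C : R, [/\ 0 < a, 0 < C & forall (r : R) x, enorm x <= r ->
    phi x <= C * (1 + r) `^ (- m) * expR (lambda * radial K r) *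
      expR (- a * (r - enorm x))].
Proof.
move=> m0 mE l0 c00 [_ _ phib].
have [d /andP[d0 _] [dK Kd]] := ae_radial.
pose a := lambda * d / 2; have a0 : 0 < a by rewrite divr_gt0// mulr_gt0.
pose k := Num.min 1 lambda / 2.
have k0 : 0 < k by rewrite divr_gt0// lt_min ltr01.
have k1 : k <= 1 / 2 by rewrite ler_pM2r// ge_min lexx.
have kl : k <= lambda / 2 by rewrite ler_pM2r// ge_min lexx orbT.
pose c1 := (a / m) `^ m; have c10 : 0 < c1 by rewrite powR_gt0// divr_gt0.
exists a, (c0^-1 * k `^ (- m) * (c1^-1 * expR a)).
split => //.
  apply: mulr_gt0; apply: mulr_gt0; rewrite ?invr_gt0//.
  - exact: powR_gt0.
  - exact: expR_gt0.
move=> r x xr; set s := enorm x; have s0 : 0 <= s := enorm_ge0 x.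
have r0 : 0 <= r by exact: le_trans xr.
have s10 : 0 < 1 + s by rewrite ltr_wpDr.
have r10 : 0 < 1 + r by rewrite ltr_wpDr.
have z0 : 0 <= r - s by rewrite subr_ge0.
have z10 : 0 < 1 + (r - s) by rewrite ltr_wpDr.
have jap : japanese (lambda * s) `^ (- m) <= k `^ (- m) * (1 + s) `^ (- m).
  rewrite -powRM ?(ltW k0) ?(ltW s10)//; apply: powRN_le; [exact: ltW|exact: mulr_gt0|].
  rewrite /japanese -[leLHS](ger0_norm (mulr_ge0 (ltW k0) (ltW s10))) -sqrtr_sqr.
  rewrite ler_sqrt; last by rewrite addr_ge0// sqr_ge0.
  have k2 : k ^+ 2 <= 1 / 4 by nra.
  have ks2 : (k * s) ^+ 2 <= (lambda * s) ^+ 2 / 4.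
    have : k * s <= lambda / 2 * s by rewrite ler_wpM2r.
    have : 0 <= k * s by rewrite mulr_ge0// ltW.
    nra.
  have := sqr_ge0 (k - k * s); have := sqr_ge0 (lambda * s); nra.
have pw : (1 + s) `^ (- m) <= (1 + r) `^ (- m) * (1 + (r - s)) `^ m.
  rewrite [X in X <= _]powRN [X in X * _]powRN mulrC ler_pdivlMr ?powR_gt0//.
  rewrite ler_pdivrMl ?powR_gt0// -powRM ?(ltW s10) ?(ltW z10)//.
  apply: ge0_ler_powR; rewrite ?nnegrE ?(ltW m0) ?(ltW r10) ?mulr_ge0 ?(ltW s10) ?(ltW z10)//.
  nra.
have pe : (1 + (r - s)) `^ m <= c1^-1 * expR a * expR (a * (r - s)).
  have := powR_le_expR a0 m0 z0; rewrite -/c1 mulrDr mulr1 expRD.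
  by rewrite -mulrA ler_pdivlMl.
have rad : expR (lambda * radial K s) <=
    expR (lambda * radial K r) * expR (- (2 * a) * (r - s)).
  rewrite -expRD ler_expR; have /andP[h _] := radial_increment d0 dK Kd s0 xr.
  have -> : - (2 * a) * (r - s) = lambda * (- (d * (r - s))) by rewrite /a; field.
  by rewrite -mulrDr ler_pM2l//; lra.
have /andP[_ /ltW h] := phib x; apply: (le_trans h); rewrite -mE -/s.
have i0 : 0 <= c0^-1 by rewrite invr_ge0 ltW.
have step1 : japanese (lambda * s) `^ (- m) <=
    k `^ (- m) * ((1 + r) `^ (- m) * (c1^-1 * expR a * expR (a * (r - s)))).
  apply: (le_trans jap); rewrite ler_wpM2l ?powR_ge0//; apply: (le_trans pw).
  by rewrite ler_wpM2l ?powR_ge0.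
have e3 : expR (- a * (r - s)) = expR (a * (r - s)) * expR (- (2 * a) * (r - s)).
  by rewrite -expRD; congr expR; ring.
rewrite (@le_trans _ _ (c0^-1 *
  (k `^ (- m) * ((1 + r) `^ (- m) * (c1^-1 * expR a * expR (a * (r - s))))) *
  (expR (lambda * radial K r) * expR (- (2 * a) * (r - s)))))//.
  apply: ler_pM; rewrite ?mulr_ge0 ?powR_ge0 ?expR_ge0//.
  by rewrite ler_wpM2l.
by rewrite e3 le_eqVlt; apply/orP; left; apply/eqP; ring.
Qed.

(** The boundary layer has volume of order [(1 + r)^(n - 1) = (1 + r)^(2 m)], and half
    of this power is compensated by the decay of the amplitude of [phi]. *)
Lemma phi_mass (lambda c0 m : R) (phi : 'rV[R]_n -> R) : (0 < n)%N -> 0 < m ->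
  m = (n%:R - 1) / 2 -> 0 < lambda -> 0 < c0 ->
  phi_lambda g K lambda c0 phi ->
  exists2 C : R, 0 < C & forall (r : R) (chi : 'rV[R]_n -> R), 0 <= r ->
    continuous chi -> (forall x, 0 <= chi x <= 1) ->
    (forall x, r < enorm x -> chi x = 0) ->
    vint g (fun x => phi x * chi x) <= C * (1 + r) `^ m * expR (lambda * radial K r).
Proof.
move=> n0 m0 mE l0 c00 ph.
have [a [C1 [a0 C10 layer]]] := phi_layer m0 mE l0 c00 ph.
have [B B0 volB] := vol_bounded.
have [D D0 expD] := @exp_ball R n a n0 a0.
case: ph => sphi _ phib.
have phi0 x : 0 <= phi x by have /andP[/(lt_trans c00)/ltW] := phib x.
exists (C1 * B * D); first by rewrite !mulr_gt0.
move=> r chi r0 cchi chi01 chir.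
have r10 : 0 < 1 + r by rewrite ltr_wpDr.
pose A := C1 * (1 + r) `^ (- m) * expR (lambda * radial K r) * B.
have A0 : 0 <= A by rewrite !mulr_ge0 ?powR_ge0 ?expR_ge0// ltW.
have iF : mu.-integrable setT (EFin \o
    (fun t => phi (rV_of t) * chi (rV_of t) * vol_density g (rV_of t))).
  have cp : continuous (fun x => phi x * chi x).
    have cphi : continuous phi by exact: smooth_continuous.
    by move=> x; exact: (cvgM (cphi x) (cchi x)).
  have cp0 x : r < enorm x -> phi x * chi x = 0 by move=> xr; rewrite chir// mulr0.
  have := vint_integrable ae_riemannian (loc_integrable_cst 1) cp cp0.
  by apply: eq_integrable => // t _ /=; rewrite mul1r.
have mb := @measurable_eball R n r.
have bound : (\int[mu]_t (phi (rV_of t) * chi (rV_of t) * vol_density g (rV_of t))%:E <=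
    (A * (D * (1 + r) ^+ n.-1))%:E)%E.
  rewrite (@le_trans _ _ (\int[mu]_(t in @eball R n r)
      (A * expR (- a * (r - enorm (rV_of t))))%:E)%E)//.
    rewrite [leRHS]integral_mkcond; apply: ge0_le_integral => //.
    - by move=> t _; rewrite lee_fin !mulr_ge0 ?vol_ge0//; have /andP[] := chi01 (rV_of t).
    - exact: measurable_int iF.
    - apply/(measurable_restrictT _ mb); apply/measurable_EFinP.
      by apply: measurable_funM => //; apply/measurable_EFinP; exact: exp_weight_measurable.
    - move=> t _; rewrite patchE; case: ifPn => [/set_mem tr|]; last first.
        rewrite notin_setE /eball/= => /negP; rewrite -ltNge => tr.
        by rewrite chir ?mulr0 ?mul0r.
      rewrite lee_fin /A [leRHS]mulrAC; apply: ler_pM; rewrite ?mulr_ge0 ?vol_ge0//.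
        by have /andP[] := chi01 (rV_of t).
      apply: le_trans (layer _ _ tr); rewrite ler_piMr//.
      by have /andP[] := chi01 (rV_of t).
  under eq_integral do rewrite EFinM.
  rewrite ge0_integralZl//; last exact: exp_weight_measurable.
  by rewrite [leRHS]EFinM lee_wpmul2l// expD.
rewrite /vint /Rintegral -lee_fin fineK; last exact: integrable_fin_num.
apply: (le_trans bound); rewrite lee_fin.
have -> : (1 + r) ^+ n.-1 = (1 + r) `^ m * (1 + r) `^ m.
  rewrite -powRD; last by rewrite (gt_eqF r10) implybT.
  rewrite -powR_mulrn ?(ltW r10)//; congr (_ `^ _).
  by rewrite mE -{2 3}(prednK n0) -natr1; field.
have inv : (1 + r) `^ (- m) * (1 + r) `^ m = 1.
  by rewrite -powRD ?addNr ?powRr0// (gt_eqF r10) implybT.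
rewrite le_eqVlt; apply/orP; left; apply/eqP.
transitivity (C1 * B * D * (1 + r) `^ m * expR (lambda * radial K r) *
  ((1 + r) `^ (- m) * (1 + r) `^ m)); last by rewrite inv mulr1.
rewrite /A; ring.
Qed.

End geometry.

(** * Supports of distributions *)

Section distributional_support.
Context {R : realType} {n : nat}.
Local Notation V := 'rV[R]_n.
Implicit Types (psi theta : V -> R) (T : \bar R) (u : R -> functional R n) (t s : R).

Lemma test_function0 : test_function (fun _ : V => 0 : R).
Proof.
split; first exact: smooth_cst.
rewrite /tsupp (_ : mkset _ = set0); last by apply/seteqP; split=> x //=; rewrite eqxx.
by rewrite closure0; exact: compact0.
Qed.

Section linearity.
Context (D : functional R n) (dD : is_distribution D).

Lemma distrD psi theta : test_function psi -> test_function theta ->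
  D (fun x => psi x + theta x) = D psi + D theta.
Proof.
move=> tp tt; have [lin _] := dD; have := lin 1 psi theta tp tt.
by rewrite mul1r => <-; congr D; apply/funext => x; rewrite mul1r.
Qed.

Lemma distr0 : D (fun=> 0) = 0.
Proof.
have := distrD test_function0 test_function0.
rewrite (_ : (fun x => _) = fun=> 0); last by apply/funext => x; rewrite addr0.
by move/eqP; rewrite -subr_eq0 opprD addrA subrr sub0r oppr_eq0 => /eqP.
Qed.

Lemma distrZ (a : R) psi : test_function psi -> D (fun x => a * psi x) = a * D psi.
Proof.
move=> tp; have [lin _] := dD; have := lin a psi _ tp test_function0.
by rewrite distr0 addr0 => <-; congr D; apply/funext => x; rewrite addr0.
Qed.

Lemma distrB psi theta : test_function psi -> test_function theta ->
  D (fun x => psi x - theta x) = D psi - D theta.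
Proof.
move=> tp tt; rewrite (_ : (fun x => _) = fun x => psi x + (-1) * theta x).
  by rewrite distrD ?distrZ ?mulN1r//; exact: test_functionZ.
by apply/funext => x; rewrite mulN1r.
Qed.

End linearity.

(** From local vanishing to vanishing on compactly supported test functions:
    each cutoff [b] peels one ball off the support, [psi = b psi + (1 - b) psi]. *)
Lemma vanish_finite_cover T u t (de : V -> R) (l : seq V) :
  (forall s, times T s -> is_distribution (u s)) ->
  (forall x, x \in l -> 0 < de x /\ forall s psi, times T s -> `|s - t| < de x ->
     test_function psi -> tsupp psi `<=` [set y | enorm (y - x) < de x] -> u s psi = 0) ->
  exists2 d : R, 0 < d & forall s psi, times T s -> `|s - t| < d ->
    test_function psi ->
    (forall y, tsupp psi y -> exists2 x, x \in l & enorm (y - x) < de x / 2) ->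
    u s psi = 0.
Proof.
move=> du; elim: l => [|x l IH] hl.
  exists 1 => // s psi sT _ tp nil; rewrite (_ : psi = fun=> 0).
    exact: (distr0 (du s sT)).
  apply/funext => y; apply/eqP; apply: contraT => /tsuppP/nil[z].
  by rewrite in_nil.
have [d d0 hd] : exists2 d : R, 0 < d & forall s psi, times T s -> `|s - t| < d ->
    test_function psi ->
    (forall y, tsupp psi y -> exists2 x, x \in l & enorm (y - x) < de x / 2) ->
    u s psi = 0.
  by apply: IH => y yl; apply: hl; rewrite in_cons yl orbT.
have [dx0 hx] := hl x (mem_head _ _).
exists (Num.min d (de x)); first by rewrite lt_min d0.
move=> s psi sT; rewrite lt_min => /andP[sd sx] tp cov.
set e := de x in dx0 hx cov sx *.
have e24 : 0 <= e / 2 < e * (3 / 4) by apply/andP; split; lra.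
set b := cutoff x (e / 2) (e * (3 / 4)).
have sb : smooth b by exact: smooth_cutoff.
have tbp : test_function (fun y => b y * psi y) by exact: test_functionM.
have tcp : test_function (fun y => psi y - b y * psi y) by exact: test_functionB.
have -> : psi = fun y => b y * psi y + (psi y - b y * psi y).
  by apply/funext => y; rewrite addrC subrK.
rewrite (distrD (du s sT))// hx// ?add0r; last first.
  apply: (@subset_trans _ [set y | enorm (y - x) <= e * (3 / 4)]).
    apply: tsupp_sub; first exact: closed_enormB_le.
    move=> y; apply: contra_neqT; rewrite -ltNge => /ltW ye.
    by rewrite /b cutoff_out// mul0r.
  by move=> y /=; move/le_lt_trans; apply; lra.
apply: hd => // y yt.
have : (tsupp psi `&` ~` [set z | enorm (z - x) < e / 2]) y.
  apply: (tsupp_sub (f := fun y => psi y - b y * psi y)) yt.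
    apply: closedI; first exact: closed_closure.
    by apply: open_closedC; exact: open_enormB_lt.
  move=> z bz; split.
    by apply: tsuppP; apply: contra_neq bz => ->; rewrite mulr0 subrr.
  move=> /= /ltW ze; move/eqP: bz; apply.
  by rewrite /b cutoff_in// mul1r subrr.
move=> [/cov[z]]; rewrite in_cons => /predU1P[->|zl] zy /=; first by [].
by exists z.
Qed.

(** Compactness of the support of [theta] makes a neighbourhood of [t] uniform; a
    whole neighbourhood is needed in order to differentiate in time. *)
Lemma vanish_off_support T u t theta (D : set (R * V)) :
  (forall s, times T s -> is_distribution (u s)) -> times T t ->
  distr_supp T u `<=` D -> test_function theta ->
  (forall x, tsupp theta x -> ~ D (t, x)) ->
  exists2 d : R, 0 < d & forall s, times T s -> `|s - t| < d -> u s theta = 0.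
Proof.
move=> du tT uD tt off.
have loc (x : V) : exists d : R, tsupp theta x -> 0 < d /\
    forall s psi, times T s -> `|s - t| < d -> test_function psi ->
    tsupp psi `<=` [set y | enorm (y - x) < d] -> u s psi = 0.
  have [xt|] := pselect (tsupp theta x); last by move=> nx; exists 0 => /nx.
  have : ~ distr_supp T u (t, x) by move=> /uD; exact: off.
  rewrite /distr_supp/= => /not_andP[//|/contrapT[d [d0 hd]]].
  by exists d.
have [de hde] := choice loc.
have : finite_subset_cover (tsupp theta)
    (fun x => [set y | enorm (y - x) < de x / 2]) (tsupp theta).
  have ct : compact (tsupp theta) by case: tt.
  move: ct; rewrite compact_cover; apply.
    by move=> x _; exact: open_enormB_lt.
  move=> x xt; exists x => //=; rewrite subrr.
  have -> : enorm (0 : V) = 0.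
    by rewrite /enorm big1 ?sqrtr0// => i _; rewrite mxE expr0n.
  by rewrite divr_gt0//; case: (hde x xt).
move=> [F Fsub cov].
have [d d0 hd] := @vanish_finite_cover T u t de (finmap.enum_fset F) du
  (fun x xF => hde x (set_mem (Fsub x xF))).
exists d => // s sT st; apply: hd => // y yt; have [x xF yx] := cov y yt; exists x => //.
Qed.

Lemma times_nbhs T t : 0 < t -> (t%:E < T)%E -> \forall s \near t, times T s.
Proof.
move=> t0 tT; have pos : \forall s \near t, 0 < s by exact: lt_nbhsr.
have bnd : \forall s \near t, (s%:E < T)%E.
  case: T tT => [r|_|//]; last by near=> s; exact: ltry.
  by rewrite lte_fin => /lt_nbhsl; apply: filterS => s; rewrite lte_fin.
by apply: filterS2 pos bnd => s s0 sT; split => //; exact: ltW.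
Unshelve. all: by end_near. Qed.

Lemma deriv_distr_interior T u ut psi t : deriv_distr T u ut -> test_function psi ->
  0 < t -> (t%:E < T)%E -> is_derive t 1 (fun s => u s psi) (ut t psi).
Proof.
move=> dv tp t0 tT.
have tin : times T t by split => //; exact: ltW.
have cv : (fun s => (u s psi - u t psi) / (s - t)) @ t^' --> ut t psi.
  apply: cvg_trans (dv psi tp t tin); move=> A; rewrite /within/= => hA.
  have tn : t^' (times T).
    by rewrite /dnbhs /within/=; apply: filterS (times_nbhs t0 tT) => s ? _.
  by apply: filterS2 tn hA => s ts; apply.
apply/is_derive1_caratheodory.
exists (fun s => if s == t then ut t psi else (u s psi - u t psi) / (s - t)); split.
- move=> s; have [->|st] := eqVneq s t; first by rewrite !subrr mulr0.
  by rewrite divfK// subr_eq0.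
- apply/continuous_withinNx; rewrite eqxx; apply: cvg_trans cv.
  apply: near_eq_cvg; near=> s.
  by rewrite ifN//; near: s; exact: nbhs_dnbhs_neq.
- by rewrite eqxx.
Unshelve. all: by end_near. Qed.

Lemma deriv_vanish T u ut psi t : deriv_distr T u ut -> test_function psi ->
  0 < t -> (t%:E < T)%E ->
  (exists2 d : R, 0 < d & forall s, times T s -> `|s - t| < d -> u s psi = 0) ->
  ut t psi = 0.
Proof.
move=> dv tp t0 tT [d d0 hd].
have dt := deriv_distr_interior dv tp t0 tT.
have d00 : is_derive t 1 (fun s => u s psi) 0.
  apply: (@near_eq_is_derive _ _ _ (fun=> 0)).
    near=> s; apply/esym/hd; first by near: s; exact: times_nbhs.
    by rewrite distrC; near: s; apply: cvgr_dist_lt; [exact: cvg_id|].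
by rewrite -(@derive_val _ _ _ _ _ _ _ dt) (@derive_val _ _ _ _ _ _ _ d00).
Unshelve. all: by end_near. Qed.

End distributional_support.

(** * Pairing a solution with the eigenfunction *)

Section second_order.
Context {R : realType}.
Implicit Types (b T t : R).

(** Factor [d^2/dt^2 - b^2] in two ways. Applying [d/dt + b] to [G' - b G] gives
    [F >= 0], so [G' - b G] stays nonnegative; applying [d/dt - b] to [G' + b G] gives
    [F] again, and this combination carries the growth. *)
Lemma second_order_growth b T (G G1 G2 F : R -> R) : 0 < b ->
  (forall t, 0 < t < T -> is_derive t 1 G (G1 t) /\ is_derive t 1 G1 (G2 t)) ->
  {within `[0, T], continuous G} -> {within `[0, T], continuous G1} ->
  (forall t, 0 < t < T -> G2 t = b ^+ 2 * G t + F t) ->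
  (forall t, 0 < t < T -> 0 <= F t) -> 0 <= G1 0 - b * G 0 ->
  let x := fun t => expR (- b * t) * (G1 t + b * G t) / 2 in
  [/\ forall t, 0 < t < T -> is_derive t 1 x (expR (- b * t) * F t / 2),
      {within `[0, T], continuous x} &
      forall t, 0 <= t <= T -> expR (b * t) * x t <= G1 t].
Proof.
move=> b0 dG cG cG1 eqn F0 ini x.
have dexp (k t : R) : is_derive t 1 (fun s => expR (k * s)) (expR (k * t) * k).
  have dk : is_derive t 1 (fun s => k * s) k.
    have dk := @is_deriveM _ _ (cst k) id t 1 0 1 (is_derive_cst _ _ _) (is_derive_id _ _).
    by apply: (is_derive_eq dk); rewrite /= scaler0 addr0 [_ *: 1]mulr1.
  exact: (@is_derive1_comp _ expR (fun s => k * s) t _ _ (is_derive_expR _) dk).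
have cexp (k : R) : {within `[0, T], continuous (fun s => expR (k * s))}.
  apply: continuous_subspaceT => t; apply/differentiable_continuous/derivable1_diffP.
  exact: (@ex_derive _ _ _ _ _ _ _ (dexp k t)).
have comb (k l t : R) : 0 < t < T -> is_derive t 1
    (fun s => expR (k * s) * (G1 s + l * G s))
    (expR (k * t) * (G2 t + l * G1 t) + (G1 t + l * G t) * (expR (k * t) * k)).
  move=> tT; have [d0 d1] := dG t tT.
  have dl : is_derive t 1 (fun s => l * G s) (l * G1 t).
    have dl := @is_deriveM _ _ (cst l) G t 1 0 (G1 t) (is_derive_cst _ _ _) d0.
    by apply: (is_derive_eq dl); rewrite /= scaler0 addr0.
  have ds := is_deriveD d1 dl.
  exact: (is_deriveM (dexp k t) ds).
have ccomb (k l : R) : {within `[0, T], continuous (fun s => expR (k * s) * (G1 s + l * G s))}.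
  move=> t; apply: cvgM; first exact: cexp.
  apply: cvgD; first exact: cG1.
  by apply: cvgM; [exact: cvg_cst|exact: cG].
have z_ge0 t : 0 <= t <= T -> 0 <= G1 t - b * G t.
  move=> /andP[t0 tT].
  have := @MVT_lower_bound R (fun s => expR (b * s) * (G1 s + (- b) * G s))
    (fun s => expR (b * s) * F s) 0 t 0 t0.
  rewrite mul0r addr0 mulr0 expR0 mul1r !mulNr => h.
  have : 0 <= expR (b * t) * (G1 t - b * G t).
    apply: (le_trans ini); apply: h.
    - move=> s /andP[s0 st]; have sT : 0 < s < T by rewrite s0 (lt_le_trans st).
      apply: (is_derive_eq (comb b (- b) s sT)).
      by rewrite eqn//; ring.
    - apply: continuous_subspaceW (ccomb b (- b)) => s /=; rewrite !in_itv/=.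
      by move=> /andP[-> st]; exact: le_trans tT.
    - move=> s /andP[s0 st]; rewrite mulr_ge0 ?expR_ge0// F0// s0.
      exact: lt_le_trans tT.
  by rewrite pmulr_rge0 ?expR_gt0.
split.
- move=> t tT; rewrite /x.
  have dh := is_deriveM (comb (- b) b t tT) (@is_derive_cst R R R (2^-1) t 1).
  apply: (is_derive_eq dh); rewrite /= scaler0 add0r eqn// [_ *: _]mulrC.
  by congr (_ * _); ring.
- move=> t; apply: cvgM; first exact: ccomb.
  exact: cvg_cst.
- move=> t tT; rewrite /x !mulrA -expRD mulNr subrr expR0 mul1r.
  have := z_ge0 t tT; lra.
Qed.

End second_order.

Section components.
Context {R : realType} {n : nat} (g : 'rV[R]_n -> 'M[R]_n) (K : R -> R).
Context (ae : asymptotically_euclidean g K).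
Context (lambda c0 m : R) (phi : 'rV[R]_n -> R).
Context (n0 : (0 < n)%N) (m0 : 0 < m) (mE : m = (n%:R - 1) / 2).
Context (l0 : 0 < lambda) (c00 : 0 < c0) (ph : phi_lambda g K lambda c0 phi).
Context (d : R) (d0 : 0 < d).
Context (dK : forall r : R, 0 < r -> derivable K r 1).
Context (Kd : forall r : R, 0 < r -> d < K r < d^-1).
Local Notation V := 'rV[R]_n.
Let gR := ae_riemannian ae.

Lemma phi_smooth : smooth phi. Proof. by case: ph. Qed.

Lemma phi_gt0 x : 0 < phi x.
Proof. by case: ph => _ _ /(_ x)/andP[+ _]; exact: lt_trans. Qed.

Definition truncated (r1 : R) : V -> R := fun x => cutoff (0 : V) r1 (r1 + 1) x * phi x.

Lemma test_truncated r1 : 0 <= r1 -> test_function (truncated r1).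
Proof.
move=> r10; have r11 : 0 <= r1 < r1 + 1 by rewrite r10 ltrDl ltr01.
have := test_functionM phi_smooth (test_cutoff (n := n) r11).
by rewrite (_ : (fun x => _) = truncated r1)//; apply/funext => x; rewrite mulrC.
Qed.

Lemma truncated_in r1 x : 0 <= r1 -> enorm x <= r1 -> truncated r1 x = phi x.
Proof.
move=> r10 xr; rewrite /truncated cutoff_in ?mul1r//; first by rewrite r10 ltrDl ltr01.
by rewrite subr0.
Qed.

Lemma truncated_out r1 x : 0 <= r1 -> r1 + 1 <= enorm x -> truncated r1 x = 0.
Proof.
move=> r10 xr; rewrite /truncated cutoff_out ?mul0r//; first by rewrite r10 ltrDl ltr01.
by rewrite subr0.
Qed.

Lemma truncated_ge0 r1 x : 0 <= truncated r1 x.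
Proof. by rewrite mulr_ge0 ?cutoff_ge0// ltW// phi_gt0. Qed.

Lemma truncated_le r1 r2 x : 0 <= r1 -> r1 + 1 <= r2 -> truncated r1 x <= truncated r2 x.
Proof.
move=> r10 r12; have r20 : 0 <= r2 by rewrite (le_trans r10)// (le_trans _ r12)// lerDl.
have [xr|xr] := leP (enorm x) r2.
  by rewrite (truncated_in r20 xr) ler_piMl ?(ltW (phi_gt0 _))// cutoff_le1.
by rewrite truncated_out// ?truncated_ge0// (le_trans r12)// ltW.
Qed.

Lemma cone_radius (a R1 t : R) (x : V) : cone K a R1 (t, x) -> enorm x <= (a * t + R1) / d.
Proof.
rewrite /cone/= => h; rewrite ler_pdivlMr// mulrC.
have /andP[+ _] := radial_increment d0 dK Kd (lexx 0) (enorm_ge0 x).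
by rewrite radial0 !subr0 => /le_trans; apply.
Qed.

Section one_component.
Context (a R1 rho : R) (T : \bar R) (eps : R) (f0 f1 : V -> R).
Context (F : R -> V -> R) (u ut utt : R -> functional R n).
Context (a0 : 0 < a) (R10 : 0 <= R1).
Context (C2 : C2_distr T u ut utt) (wp : wave_problem g T a eps f0 f1 F u ut utt).
Context (us : distr_supp T u `<=` cone K a R1).

Lemma solution_distr t : times T t -> is_distribution (u t).
Proof. by case: C2 => -[+ _] _ _ _ _; exact. Qed.

Lemma off_cone theta t : times T t -> test_function theta ->
  (forall x, tsupp theta x -> ~ cone K a R1 (t, x)) ->
  exists2 e : R, 0 < e & forall s, times T s -> `|s - t| < e -> u s theta = 0.
Proof. by move=> tT tt off; exact: (vanish_off_support solution_distr tT us tt off). Qed.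

Lemma tsupp_far theta r : (forall x, enorm x < r -> theta x = 0) ->
  tsupp theta `<=` [set x : V | r <= enorm x].
Proof.
move=> h; apply: tsupp_sub.
  rewrite (_ : mkset _ = ~` [set x : V | enorm (x - 0) < r]).
    by apply: open_closedC; exact: open_enormB_lt.
  apply/seteqP; split=> x /=; rewrite subr0.
    by move=> rx; apply/negP; rewrite -leNgt.
  by move/negP; rewrite -leNgt.
by move=> x; apply: contra_neqT; rewrite -ltNge; exact: h.
Qed.

(** The Laplacian of the truncation equals [lambda^2] times the truncation except
    where the cutoff varies, which is off the support of [u t]. *)
Lemma component_identity t : 0 < t -> (t%:E < T)%E -> (a * t + R1) / d < rho ->
  utt t (truncated rho) = (a * lambda) ^+ 2 * u t (truncated rho) +
    vint g (fun x => F t x * truncated rho x).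
Proof.
move=> t0 tT trho; have tin : times T t by split => //; exact: ltW.
have r0 : 0 <= rho.
  rewrite (le_trans _ (ltW trho))// divr_ge0 ?(ltW d0)// addr_ge0//.
  by rewrite mulr_ge0 ?(ltW a0) ?(ltW t0).
have tp := test_truncated r0; have tl := test_laplace gR tp.
have [eqn _ _] := wp; have := eqn t t0 tT _ tp.
rewrite /distr_laplace /distr_of_fun => /eqP; rewrite subr_eq => /eqP ->.
rewrite addrC; congr (_ + _); rewrite exprMn -[RHS]mulrA; apply: (congr1 ( *%R (a ^+ 2))).
have tz := test_functionZ (lambda ^+ 2) tp.
have : u t (fun x => laplace_beltrami g (truncated rho) x - lambda ^+ 2 * truncated rho x) = 0.
  have tB := test_functionB tl tz.
  have [|e e0 he] := off_cone tin tB.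
    move=> x /(tsupp_far (r := rho))/= far /cone_radius xr.
    have : rho <= enorm x.
      apply: far => y yr.
      rewrite (@laplace_local _ _ _ _ phi).
        by case: ph => _ -> _; rewrite truncated_in ?subrr// ltW.
      have : \forall z \near y, enorm z < rho.
        have : open [set z : V | enorm (z - 0) < rho] by exact: open_enormB_lt.
        rewrite openE => /(_ y); rewrite /= subr0 => /(_ yr).
        by apply: filterS => z /=; rewrite subr0.
      by apply: filterS => z zr; rewrite truncated_in// ltW.
    by rewrite leNgt (le_lt_trans xr).
  by apply: he => //; rewrite subrr normr0.
rewrite (distrB (solution_distr tin))// (distrZ (solution_distr tin))// => /eqP.
by rewrite subr_eq0 => /eqP.
Qed.

(** The large truncation serves all times at once; at a given time it may be
    replaced by one that follows the cone, whose mass is under control. *)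
Lemma component_localize t r : 0 < t -> (t%:E < T)%E -> 0 <= r ->
  (forall x : V, cone K a R1 (t, x) -> enorm x <= r) -> r + 1 <= rho ->
  ut t (truncated rho) = ut t (truncated (r + 1)).
Proof.
move=> t0 tT r0 conr rrho; have tin : times T t by split => //; exact: ltW.
have r10 : 0 <= r + 1 by rewrite addr_ge0.
have rho0 : 0 <= rho by exact: le_trans rrho.
have tp := test_truncated rho0; have tq := test_truncated r10.
have [_ [dut _] _ du _] := C2.
apply/eqP; rewrite -subr_eq0 -(distrB (dut t tin))//; apply/eqP.
have tB := test_functionB tp tq.
apply: (deriv_vanish du tB t0 tT); apply: (off_cone tin tB) => x xt /conr xr.
have /= : [set y : V | r + 1 <= enorm y] x.
  apply: (tsupp_far _ xt) => y yr; rewrite (truncated_in r10 (ltW yr)).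
  by rewrite (truncated_in rho0 (le_trans (ltW yr) rrho)) subrr.
by rewrite leNgt (le_lt_trans xr)// ltrDl.
Qed.

Lemma initial_pairing (f : V -> R) R0 : test_function f ->
  tsupp f `<=` [set x : V | enorm x <= R0] -> 0 <= rho -> R0 <= rho ->
  vint g (fun x => eps * f x * truncated rho x) = eps * vint g (fun x => f x * phi x).
Proof.
move=> [sf _] fs rho0 Rrho.
have fR x : R0 < enorm x -> f x * phi x = 0.
  move=> xR; have -> : f x = 0; last by rewrite mul0r.
  by apply/eqP; apply: contraTT xR => /tsuppP/fs/=; rewrite -leNgt.
have cfp : continuous (fun x => f x * phi x).
  exact: (smooth_continuous (smoothM sf phi_smooth)).
have := vintZ gR eps (loc_integrable_cst 1) cfp fR.
rewrite (_ : (fun x => eps * (1 * (f x * phi x))) = fun x => eps * f x * truncated rho x).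
  by move=> ->; congr (_ * vint g _); apply/funext => x; rewrite mul1r.
apply/funext => x; rewrite mul1r -mulrA; congr (_ * _).
have [->|fx] := eqVneq (f x) 0; first by rewrite !mul0r.
by rewrite truncated_in// (le_trans _ Rrho)//; exact/fs/tsuppP.
Qed.

Lemma component_energy T1 R0 A : 0 < T1 -> (T1%:E < T)%E ->
  (a * T1 + R1) / d < rho -> R0 <= rho -> 0 < eps ->
  (forall t x, 0 <= F t x) ->
  test_function f0 -> test_function f1 -> (forall x, 0 <= f0 x) ->
  tsupp f0 `<=` [set x | enorm x <= R0] -> tsupp f1 `<=` [set x | enorm x <= R0] ->
  A = vint g (fun x => (f1 x - a * lambda * f0 x) * phi x) -> 0 < A ->
  let x := fun t => expR (- (a * lambda) * t) *
    (ut t (truncated rho) + a * lambda * u t (truncated rho)) / 2 in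
  [/\ forall t, 0 < t < T1 -> is_derive t 1 x (expR (- (a * lambda) * t) *
        vint g (fun x => F t x * truncated rho x) / 2),
      {within `[0, T1], continuous x},
      forall t, 0 <= t <= T1 -> expR (a * lambda * t) * x t <= ut t (truncated rho) &
      eps * (A / 2) <= x 0].
Proof.
move=> T10 T1T trho R0rho eps0 F0 tf0 tf1 f00 s0 s1 AE A0 x.
have rho0 : 0 <= rho.
  rewrite (le_trans _ (ltW trho))// divr_ge0 ?(ltW d0)// addr_ge0//.
  by rewrite mulr_ge0 ?(ltW a0) ?(ltW T10).
have tp := test_truncated rho0.
have [[_ cu] [_ cut] _ du dut] := C2.
have [_ ini0 ini1] := wp.
have inT t : 0 < t < T1 -> 0 < t /\ (t%:E < T)%E.
  by move=> /andP[-> tT1]; split => //; apply: lt_trans T1T; rewrite lte_fin.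
have sub : `[0, T1]%classic `<=` times T.
  move=> t /=; rewrite in_itv/= => /andP[t0 tT1]; split => //.
  by apply: le_lt_trans T1T; rewrite lee_fin.
have u0E : u 0 (truncated rho) = eps * vint g (fun x => f0 x * phi x).
  by rewrite (ini0 _ tp) /distr_of_fun; exact: (initial_pairing tf0 s0).
have ut0E : ut 0 (truncated rho) = eps * vint g (fun x => f1 x * phi x).
  by rewrite (ini1 _ tp) /distr_of_fun; exact: (initial_pairing tf1 s1).
have AE' : A = vint g (fun x => f1 x * phi x) - a * lambda * vint g (fun x => f0 x * phi x).
  have supp0 f x' : tsupp f `<=` [set x | enorm x <= R0] -> R0 < enorm x' -> f x' * phi x' = 0.
    move=> fs xR; have -> : f x' = 0; last by rewrite mul0r.
    by apply/eqP; apply: contraTT xR => /tsuppP/fs/=; rewrite -leNgt.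
  have c0' : continuous (fun x => f0 x * phi x).
    by apply: smooth_continuous; apply: smoothM; [case: tf0|exact: phi_smooth].
  have c1' : continuous (fun x => f1 x * phi x).
    by apply: smooth_continuous; apply: smoothM; [case: tf1|exact: phi_smooth].
  have z0 y : R0 < enorm y -> f0 y * phi y = 0 by exact: supp0.
  have z1 y : R0 < enorm y -> f1 y * phi y = 0 by exact: supp0.
  rewrite AE.
  have := vintD gR (loc_integrable_cst 1) c1' (loc_integrable_cst (- (a * lambda))) c0' z1 z0.
  have := vintZ gR (- (a * lambda)) (loc_integrable_cst 1) c0' z0.
  have e1 f : (fun y => 1 * (f y * phi y)) = (fun y => f y * phi y).
    by apply/funext => y; rewrite mul1r.
  rewrite (_ : (fun y => - (a * lambda) * (1 * (f0 y * phi y))) =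
    (fun y => - (a * lambda) * (f0 y * phi y))); last first.
    by apply/funext => y; rewrite mul1r.
  rewrite !e1 => ->; rewrite mulNr => <-; congr (vint g _); apply/funext => y; ring.
have I0 : 0 <= vint g (fun x => f0 x * phi x).
  by apply: vint_ge0 => y; rewrite mulr_ge0// ltW// phi_gt0.
have al0 : 0 < a * lambda by exact: mulr_gt0.
have [||||||dx cx xle] := @second_order_growth R (a * lambda) T1
  (fun t => u t (truncated rho)) (fun t => ut t (truncated rho))
  (fun t => utt t (truncated rho)) (fun t => vint g (fun x => F t x * truncated rho x)) al0.
- move=> t /inT[t0 tT]; split.
    exact: (deriv_distr_interior du tp t0 tT).
  exact: (deriv_distr_interior dut tp t0 tT).
- by apply: continuous_subspaceW (cu _ tp).
- by apply: continuous_subspaceW (cut _ tp).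
- move=> t /[dup] /inT[t0 tT] /andP[_ tT1]; apply: component_identity => //.
  by apply: le_lt_trans trho; rewrite ler_pM2r ?invr_gt0// lerD2r ler_pM2l// ltW.
- by move=> t _; apply: vint_ge0 => y; rewrite mulr_ge0 ?truncated_ge0.
- rewrite u0E ut0E mulrCA -mulrBr -AE'; apply: mulr_ge0; exact: ltW.
split => //.
rewrite /x mulr0 expR0 mul1r u0E ut0E.
have h1 : eps * vint g (fun x => f1 x * phi x) =
    eps * A + a * lambda * (eps * vint g (fun x => f0 x * phi x)) by rewrite AE'; ring.
rewrite h1 mulrA -addrA -mulr2n ler_pM2r ?invr_gt0// lerDl.
by rewrite mulrn_wge0// !mulr_ge0// ltW.
Qed.

End one_component.

(** Jensen's inequality with the truncation that follows the cone. The factor to the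
    power [- (q - 1)] bounds the mass of [phi] on the section of the cone at time
    [t], enlarged by 2 to make room for the cutoff. *)
Lemma component_power (a R1 q : R) : 0 < a -> 0 <= R1 -> 1 < q ->
  exists2 C : R, 0 < C & forall (rho : R) (T : \bar R) (u ut utt : R -> functional R n) w t,
    C2_distr T u ut utt -> distr_supp T u `<=` cone K a R1 -> power_term g T q ut w ->
    0 < t -> (t%:E < T)%E -> (a * t + R1) / d + 3 <= rho ->
    `|ut t (truncated rho)| `^ q *
      (C * (1 + t) `^ m * expR (a * lambda * t)) `^ (- (q - 1)) <=
    vint g (fun x => `|w t x| `^ q * truncated rho x).
Proof.
move=> a0 R10 q1.
have [Cp Cp0 mass] := phi_mass ae n0 m0 mE l0 c00 ph.
pose B := 3 + (a + R1) / d.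
have B0 : 0 < B by rewrite ltr_pwDl// divr_ge0 ?(ltW d0)// addr_ge0// ltW.
exists (Cp * B `^ m * expR (lambda * (R1 + d^-1 * 2))).
  by rewrite !mulr_gt0 ?powR_gt0 ?expR_gt0.
move=> rho T u ut utt w t C2 us pw t0 tT trho.
have [wd wq _] := pw; have tin : times T t by split => //; exact: ltW.
have [wl utE] := wd t tin; have wql := wq t tin.
have at0 : 0 <= a * t + R1 by rewrite addr_ge0// mulr_ge0// ltW.
have [r r0 rE] := radial_level d0 dK Kd at0.
have conr (x : V) : cone K a R1 (t, x) -> enorm x <= r.
  rewrite /cone/= -rE => h; rewrite leNgt; apply/negP => rx.
  have /andP[+ _] := radial_increment d0 dK Kd r0 (ltW rx).
  apply/negP; rewrite -ltNge (@le_lt_trans _ _ 0) ?subr_le0//.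
  by rewrite mulr_gt0// subr_gt0.
have rle : r <= (a * t + R1) / d.
  rewrite ler_pdivlMr// mulrC -rE.
  by have /andP[+ _] := radial_increment d0 dK Kd (lexx 0) r0; rewrite radial0 !subr0.
have r10 : 0 <= r + 1 by rewrite addr_ge0.
have r2rho : r + 1 + 1 <= rho by lra.
rewrite (component_localize (rho := rho) C2 us t0 tT r0 conr); last by lra.
have tq := test_truncated r10.
have cW : continuous (truncated (r + 1)) by case: tq => /smooth_continuous.
have W0 x : r + 1 + 1 < enorm x -> truncated (r + 1) x = 0.
  by move=> xr; apply: truncated_out => //; exact: ltW.
set M := _ * (1 + t) `^ m * _.
have M0 : 0 < M.
  by rewrite !mulr_gt0 ?powR_gt0 ?expR_gt0// ltr_wpDr// ltW.
have WM : vint g (truncated (r + 1)) <= M.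
  have := mass (r + 1 + 1) (cutoff (0 : V) (r + 1) (r + 1 + 1)).
  rewrite (_ : (fun x => _) = truncated (r + 1)); last first.
    by apply/funext => x; rewrite mulrC.
  move=> h; apply: le_trans (h _ _ _ _) _.
  - by rewrite addr_ge0.
  - exact/smooth_continuous/smooth_cutoff.
  - by move=> x; rewrite cutoff_ge0 cutoff_le1.
  - move=> x xr; apply: cutoff_out; first by rewrite r10 ltrDl ltr01.
    by rewrite subr0 ltW.
  have rad : radial K (r + 1 + 1) <= a * t + (R1 + d^-1 * 2).
    have r2 : r <= r + 1 + 1 by rewrite -addrA lerDl.
    have /andP[_] := radial_increment d0 dK Kd r0 r2.
    by rewrite rE; lra.
  have sizeB : 1 + (r + 1 + 1) <= B * (1 + t).
    have : r <= (a + R1) / d * (1 + t).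
      apply: (le_trans rle); rewrite mulrAC ler_pM2r ?invr_gt0//.
      have := mulr_ge0 R10 (ltW t0); nra.
    by rewrite /B; lra.
  have -> : M = Cp * (B `^ m * (1 + t) `^ m) *
      (expR (lambda * (R1 + d^-1 * 2)) * expR (a * lambda * t)) by rewrite /M; ring.
  have t10 : 0 <= 1 + t by rewrite addr_ge0// ltW.
  rewrite -powRM ?(ltW B0)// -expRD.
  apply: ler_pM; rewrite ?expR_ge0 ?mulr_ge0 ?powR_ge0 ?(ltW Cp0)//.
    rewrite ler_pM2l//; apply: ge0_ler_powR; rewrite ?nnegrE ?(ltW m0) ?mulr_ge0 ?(ltW B0)//.
    by rewrite !addr_ge0.
  rewrite ler_expR; have := ler_wpM2l (ltW l0) rad; lra.
rewrite (utE _ tq) /distr_of_fun.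
apply: le_trans (vint_jensen gR q1 M0 wl wql cW (truncated_ge0 _) W0 WM) _.
have rho0 : 0 <= rho by lra.
have cR : continuous (truncated rho).
  by have [/smooth_continuous] := test_truncated rho0.
have W0' x : Num.max (r + 1 + 1) (rho + 1) < enorm x -> truncated (r + 1) x = 0.
  by rewrite gt_max => /andP[/W0].
have R0' x : Num.max (r + 1 + 1) (rho + 1) < enorm x -> truncated rho x = 0.
  by rewrite gt_max => /andP[_ /ltW]; exact: truncated_out.
apply: (vint_le gR wql cW wql cR W0' R0') => x.
by rewrite ler_wpM2l ?powR_ge0// truncated_le.
Qed.

End components.

(** * The lifespan *)

Section conclusion.
Context {R : realType}.

(** [b] is the rate of the driving component and [b'] that of the driven one: the
    [p]th power of [exp (b t)] meets the [p - 1]st power in the mass, and one factor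
    [exp (b t)] survives. *)
Lemma driving_bound (C b b' t m p H y : R) : 0 < C -> 0 <= t -> 0 <= y -> 1 < p ->
  expR (b * t) * y <= H ->
  C `^ (- (p - 1)) / 2 * expR ((b - b') * t) * (1 + t) `^ (- (m * (p - 1))) * y `^ p <=
  expR (- b' * t) * (`|H| `^ p * (C * (1 + t) `^ m * expR (b * t)) `^ (- (p - 1))) / 2.
Proof.
move=> C0 t0 y0 p1 yH.
have p0 : 0 < p by exact: lt_trans p1.
have h1 : expR (b * t * p) * y `^ p <= `|H| `^ p.
  rewrite expRM -powRM ?expR_ge0//.
  apply: ge0_ler_powR; rewrite ?nnegrE ?(ltW p0) ?mulr_ge0 ?expR_ge0//.
  exact: le_trans (ler_norm _).
have -> : (C * (1 + t) `^ m * expR (b * t)) `^ (- (p - 1)) =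
    C `^ (- (p - 1)) * (1 + t) `^ (- (m * (p - 1))) * expR (- (b * t * (p - 1))).
  rewrite (@powRM _ (C * (1 + t) `^ m)) ?expR_ge0 ?mulr_ge0 ?powR_ge0 ?(ltW C0)//.
  rewrite (@powRM _ C) ?powR_ge0 ?(ltW C0)// -powRrM -expRM.
  by rewrite !mulrN.
rewrite (@le_trans _ _ (expR (- b' * t) * (expR (b * t * p) * y `^ p *
  (C `^ (- (p - 1)) * (1 + t) `^ (- (m * (p - 1))) * expR (- (b * t * (p - 1))))) / 2))//.
  have -> : expR ((b - b') * t) =
      expR (- b' * t) * expR (b * t * p) * expR (- (b * t * (p - 1))).
    by rewrite -!expRD; congr expR; ring.
  by rewrite le_eqVlt; apply/orP; left; apply/eqP; ring.
rewrite ler_pM2r// ler_wpM2l ?expR_ge0// ler_wpM2r// !mulr_ge0 ?powR_ge0 ?expR_ge0//.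
Qed.

Lemma weak_solution_feedback (n : nat) (p q c : R)
    (g : 'rV[R]_n -> 'M[R]_n) (K : R -> R)
    (lambda c0 : R) (phi : 'rV[R]_n -> R)
    (u0 u1 v0 v1 : 'rV[R]_n -> R) (R0 R1 m : R) :
  (0 < n)%N -> 0 < m -> m = (n%:R - 1) / 2 -> 1 < p -> 1 < q -> 0 < c ->
  asymptotically_euclidean g K ->
  0 < lambda -> 0 < c0 -> phi_lambda g K lambda c0 phi ->
  [/\ test_function u0, test_function u1, test_function v0
    & test_function v1] ->
  (forall x, [/\ 0 <= u0 x, 0 <= u1 x, 0 <= v0 x & 0 <= v1 x]) ->
  0 < R0 ->
  [/\ tsupp u0 `<=` [set x | enorm x <= R0],
      tsupp u1 `<=` [set x | enorm x <= R0],
      tsupp v0 `<=` [set x | enorm x <= R0]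
    & tsupp v1 `<=` [set x | enorm x <= R0]] ->
  0 < vint g (fun x => (u1 x - c * lambda * u0 x) * phi x) ->
  0 < vint g (fun x => (v1 x - lambda * v0 x) * phi x) ->
  radial K R0 <= R1 ->
  exists k a : R, [/\ 0 < k, 0 < a & forall eps T u v T1, 0 < eps ->
    weak_solution g K c p q R1 u0 u1 v0 v1 eps T u v ->
    0 < T1 -> (T1%:E < T)%E ->
    exists x dx y dy : R -> R, [/\ feedback ((c - 1) * lambda) k m p q T1 x dx y dy,
      a * eps <= x 0 & a * eps <= y 0]].
Proof.
move=> n0 m0 mE p1 q1 cp ae l0 c00 ph [tu0 tu1 tv0 tv1] pos R00 [su0 su1 sv0 sv1] Au Av RR1.
have R10 : 0 <= R1 by apply: le_trans RR1; apply: (radial_ge0 ae); exact: ltW.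
have [d /andP[d0 _] [dK Kd]] := ae_radial ae.
have [Cu Cu0 powu] := component_power ae n0 m0 mE l0 c00 ph d0 dK Kd cp R10 q1.
have [Cv Cv0 powv] := component_power ae n0 m0 mE l0 c00 ph d0 dK Kd ltr01 R10 p1.
set au := vint g _ in Au; set av := vint g _ in Av.
pose ku := Cu `^ (- (q - 1)) / 2; pose kv := Cv `^ (- (p - 1)) / 2.
have ku0 : 0 < ku by rewrite divr_gt0// powR_gt0.
have kv0 : 0 < kv by rewrite divr_gt0// powR_gt0.
exists (Num.min ku kv), (Num.min au av / 2); split.
- by rewrite lt_min ku0.
- by rewrite divr_gt0// lt_min Au.
move=> eps T u v T1 eps0 [_ [ut [utt [vt [vtt [wu [wv
  [[C2u C2v] [pwu pwv] wpu wpv [su sv]]]]]]]]] T10 T1T.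
(* The ball of radius [rho] contains the data and, with room for the cutoffs, the
   sections of both cones up to the time [T1]. *)
pose rho := (Num.max 1 c * T1 + R1) / d + R0 + 3.
have mle (a t : R) : a <= Num.max 1 c -> 0 <= a -> t <= T1 -> (a * t + R1) / d + 3 + R0 <= rho.
  move=> ac a0 tT1; have : a * t <= Num.max 1 c * T1.
    by rewrite (@le_trans _ _ (a * T1)) ?ler_wpM2l// ler_wpM2r// ltW.
  rewrite -(lerD2r R1) -(ler_pM2r (_ : 0 < d^-1)) ?invr_gt0// /rho; lra.
have c1 : c <= Num.max 1 c by rewrite le_max lexx orbT.
have o1 : 1 <= Num.max 1 c by rewrite le_max lexx.
have mlt (a : R) : a <= Num.max 1 c -> 0 <= a -> (a * T1 + R1) / d < rho.
  by move=> ac a0; have := mle a T1 ac a0 (lexx _); lra.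
have R0rho : R0 <= rho.
  have : 0 <= (1 * T1 + R1) / d by rewrite divr_ge0 ?(ltW d0)// addr_ge0// mul1r ltW.
  by have := mle 1 T1 o1 ler01 (lexx _); lra.
have F0 r (w : R -> 'rV[R]_n -> R) t x : 0 <= `|w t x| `^ r by rewrite powR_ge0.
have f0u x : 0 <= u0 x by case: (pos x).
have f0v x : 0 <= v0 x by case: (pos x).
have := component_energy ae l0 c00 ph d0 dK Kd cp R10 C2u wpu su T10 T1T (mlt c c1 (ltW cp))
  R0rho eps0 (F0 p wv) tu0 tu1 f0u su0 su1 erefl Au.
set x := fun t => expR (- (c * lambda) * t) * _ / 2.
move=> /= [dx cx xle x0].
have Av1 : 0 < vint g (fun x => (v1 x - 1 * lambda * v0 x) * phi x) by rewrite mul1r.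
have := component_energy ae l0 c00 ph d0 dK Kd ltr01 R10 C2v wpv sv T10 T1T (mlt 1 o1 ler01)
  R0rho eps0 (F0 q wu) tv0 tv1 f0v sv0 sv1 erefl Av1.
rewrite mul1r; set y := fun t => expR (- lambda * t) * _ / 2.
move=> /= [dy cy yle y0].
set Iu := fun t => vint g (fun z => `|wv t z| `^ p * truncated phi rho z) in dx.
set Iv := fun t => vint g (fun z => `|wu t z| `^ q * truncated phi rho z) in dy.
have tr0 z : 0 <= truncated phi rho z by exact: (truncated_ge0 c00 ph).
have nonneg (f df : R -> R) (t : R) : 0 <= f 0 ->
    (forall s, 0 < s < T1 -> is_derive s 1 f (df s)) ->
    {within `[0, T1], continuous f} -> (forall s, 0 <= df s) -> 0 <= t <= T1 -> 0 <= f t.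
  move=> f0 dfd cf df0 /andP[t0 tT1].
  apply: (le_trans f0); have := @MVT_lower_bound R f df 0 t 0 t0; rewrite mul0r addr0; apply => //.
  - by move=> s /andP[s0 st]; apply: dfd; rewrite s0 (lt_le_trans st).
  - apply: continuous_subspaceW cf => s /=; rewrite !in_itv/= => /andP[-> st].
    exact: le_trans tT1.
have xpos t : 0 <= t <= T1 -> 0 <= x t.
  apply: nonneg dx cx _; first by rewrite (le_trans _ x0)// mulr_ge0 ?divr_ge0// ltW.
  move=> s; rewrite divr_ge0// mulr_ge0 ?expR_ge0//; apply: vint_ge0 => z.
  by rewrite mulr_ge0 ?powR_ge0.
have ypos t : 0 <= t <= T1 -> 0 <= y t.
  apply: nonneg dy cy _.
    by rewrite (le_trans _ y0)// mulr_ge0 ?divr_ge0// ltW// -(mul1r lambda).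
  move=> s; rewrite divr_ge0// mulr_ge0 ?expR_ge0//; apply: vint_ge0 => z.
  by rewrite mulr_ge0 ?powR_ge0.
exists x, (fun t => expR (- (c * lambda) * t) * Iu t / 2).
exists y, (fun t => expR (- lambda * t) * Iv t / 2).
split.
- split; [by move=> t tT1; split; [exact: dx|exact: dy]|exact: cx|exact: cy|].
  move=> t tT1.
  have /andP[t0 tT] := tT1; have t0T : 0 <= t <= T1 by rewrite (ltW t0) (ltW tT).
  have tTE : (t%:E < T)%E by apply: lt_trans T1T; rewrite lte_fin.
  have rhot a : a <= Num.max 1 c -> 0 <= a -> (a * t + R1) / d + 3 <= rho.
    by move=> ac a0; have := mle a t ac a0 (ltW tT); lra.
  have e1 : (lambda - c * lambda) * t = - ((c - 1) * lambda) * t by ring.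
  have e2 : (c * lambda - lambda) * t = (c - 1) * lambda * t by ring.
  split.
  + have := driving_bound (c * lambda) m Cv0 (ltW t0) (ypos t t0T) p1 (yle t t0T).
    rewrite e1 -/kv => h.
    apply: le_trans (le_trans h _).
      rewrite ler_wpM2r ?powR_ge0// ler_wpM2r ?powR_ge0// ler_wpM2r ?expR_ge0//.
      by rewrite ge_min lexx orbT.
    rewrite ler_pM2r ?invr_gt0// ler_wpM2l ?expR_ge0//.
    have := powv rho T v vt vtt wv t C2v sv pwv t0 tTE (rhot 1 o1 ler01).
    by rewrite mul1r.
  + have := driving_bound lambda m Cu0 (ltW t0) (xpos t t0T) q1 (xle t t0T).
    rewrite e2 -/ku => h.
    apply: le_trans (le_trans h _).
      rewrite ler_wpM2r ?powR_ge0// ler_wpM2r ?powR_ge0// ler_wpM2r ?expR_ge0//.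
      by rewrite ge_min lexx.
    rewrite ler_pM2r ?invr_gt0// ler_wpM2l ?expR_ge0//.
    exact: (powu rho T u ut utt wu t C2u su pwu t0 tTE (rhot c c1 (ltW cp))).
- apply: le_trans x0; rewrite mulrC ler_pM2l// ler_pM2r ?invr_gt0//.
  by rewrite ge_min lexx.
- apply: le_trans y0; rewrite mulrC ler_pM2l// ler_pM2r ?invr_gt0//.
  by rewrite ge_min lexx orbT.
Qed.

(** The exponent attached to [p + 1] comes from [x] and the one attached to [q + 1]
    from [y]; likewise the sign of [c - 1] decides which unknown is fed by the growing
    exponential. In each case exchanging the unknowns gives the other alternative. *)
Lemma feedback_lifespan (n : nat) (p q c lambda m k a : R) :
  0 <= m -> m = (n%:R - 1) / 2 -> 1 < p -> 1 < q -> 0 < c -> 0 < lambda -> 0 < k -> 0 < a ->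
  (c != 1 -> 0 < GammaGGstar p q n) -> (c = 1 -> 0 < GammaGG p q n) ->
  exists2 C : R, 0 < C & forall eps T1 x dx y dy, 0 < eps < 1 -> 0 <= T1 ->
    a * eps <= x 0 -> a * eps <= y 0 ->
    feedback ((c - 1) * lambda) k m p q T1 x dx y dy ->
    T1 <= if c == 1 then C * eps `^ (- (GammaGG q p n)^-1)
          else C * eps `^ (- (GammaGGstar p q n)^-1).
Proof.
move=> m0 mE p1 q1 cp l0 k0 a0 Gs G.
have pos eps z : 0 < eps < 1 -> a * eps <= z -> 0 <= z.
  by move=> /andP[e0 _]; apply: le_trans; rewrite mulr_ge0// ltW.
have [c1|c1] := eqVneq c 1.
  have pq0 : 0 < p * q - 1 by rewrite subr_gt0 -[ltLHS]mulr1; apply: ltr_pM.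
  have {}G := G c1; rewrite c1 subrr mul0r.
  have [qp|pq] := leP q p.
    have GE : GammaGG q p n = (p + 1) / (p * q - 1) - m.
      rewrite /GammaGG -mE [q * p]mulrC; congr (_ - _); apply/max_idPr.
      by rewrite ler_pM2r ?invr_gt0// lerD2r.
    have G' : 0 < (p + 1) / (p * q - 1) - m.
      by rewrite -GE /GammaGG [q * p]mulrC maxC.
    have [C C0 hC] := resonant_lifespan k0 m0 p1 q1 a0 G'.
    exists C => // eps T1 x dx y dy e01 T10 ax ay fb; rewrite GE.
    exact: hC e01 T10 ax (pos _ _ e01 ay) fb.
  have GE : GammaGG q p n = (q + 1) / (q * p - 1) - m.
    rewrite /GammaGG -mE; congr (_ - _); apply/max_idPl.
    by rewrite ler_pM2r ?invr_gt0 1?[q * p]mulrC// lerD2r ltW.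
  have G' : 0 < (q + 1) / (q * p - 1) - m.
    by rewrite -GE /GammaGG [q * p]mulrC maxC.
  have [C C0 hC] := resonant_lifespan k0 m0 q1 p1 a0 G'.
  exists C => // eps T1 x dx y dy e01 T10 ax ay /feedback_sym; rewrite oppr0 GE => fb.
  exact: hC e01 T10 ay (pos _ _ e01 ax) fb.
have {}Gs := Gs c1.
have [c2|c2] := ltP 1 c.
  have kap : 0 < (c - 1) * lambda by rewrite mulr_gt0// subr_gt0.
  have [C C0 hC] := nonresonant_lifespan kap Gs k0 m0 p1 q1 a0.
  exists C => // eps T1 x dx y dy e01 T10 ax ay fb.
  exact: hC e01 T10 ax (pos _ _ e01 ay) fb.
have kap : 0 < - ((c - 1) * lambda).
  by rewrite -mulNr opprB mulr_gt0// subr_gt0 lt_neqAle c1.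
have [C C0 hC] := nonresonant_lifespan kap Gs k0 m0 q1 p1 a0.
exists C => // eps T1 x dx y dy e01 T10 ax ay /feedback_sym fb.
exact: hC e01 T10 ay (pos _ _ e01 ax) fb.
Qed.

End conclusion.

Theorem theorem1p2 (R : realType) (n : nat) (p q c : R)
    (g : 'rV[R]_n -> 'M[R]_n) (K : R -> R)
    (lambda c0 : R) (phi : 'rV[R]_n -> R)
    (u0 u1 v0 v1 : 'rV[R]_n -> R) (R0 R1 : R) :
  (2 <= n)%N -> 1 < p -> 1 < q -> 0 < c ->
  (c != 1 -> 0 < GammaGGstar p q n) ->
  (c = 1 -> 0 < GammaGG p q n) ->
  asymptotically_euclidean g K ->
  0 < lambda -> 0 < c0 -> phi_lambda g K lambda c0 phi ->
  [/\ test_function u0, test_function u1, test_function v0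
    & test_function v1] ->
  (exists x, u0 x != 0 \/ u1 x != 0) ->
  (exists x, v0 x != 0 \/ v1 x != 0) ->
  (forall x, [/\ 0 <= u0 x, 0 <= u1 x, 0 <= v0 x & 0 <= v1 x]) ->
  0 < R0 ->
  [/\ tsupp u0 `<=` [set x | enorm x <= R0],
      tsupp u1 `<=` [set x | enorm x <= R0],
      tsupp v0 `<=` [set x | enorm x <= R0]
    & tsupp v1 `<=` [set x | enorm x <= R0]] ->
  0 < vint g (fun x => (u1 x - c * lambda * u0 x) * phi x) ->
  0 < vint g (fun x => (v1 x - lambda * v0 x) * phi x) ->
  radial K R0 <= R1 ->
  exists eps0 : R, 0 < eps0 /\
  exists C : R, 0 < C /\
  forall eps : R, 0 < eps < eps0 ->
  forall (T : \bar R) (u v : R -> functional R n),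
    weak_solution g K c p q R1 u0 u1 v0 v1 eps T u v ->
    let Teps := lifespan g K c p q R1 u0 u1 v0 v1 eps T u v in
    (Teps < +oo)%E /\
    (Teps <= (if c == 1 then C * eps `^ (- (GammaGG q p n)^-1)
              else C * eps `^ (- (GammaGGstar p q n)^-1))%:E)%E.
Proof.
move=> n2 p1 q1 cp Gs G ae l0 c00 ph tests _ _ pos R00 supps Au Av RR1.
pose m : R := (n%:R - 1) / 2.
have n0 : (0 < n)%N by exact: leq_trans n2.
have m0 : 0 < m by rewrite divr_gt0// subr_gt0 ltr1n.
have [k [a [k0 a0 fb]]] := weak_solution_feedback n0 m0 erefl p1 q1 cp ae l0 c00 ph
  tests pos R00 supps Au Av RR1.
have [C C0 bound] := feedback_lifespan (ltW m0) erefl p1 q1 cp l0 k0 a0 Gs G.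
exists 1; split => //; exists C; split => // eps e01 T u v _ Teps.
set B := if c == 1 then _ else _.
have eps0 : 0 < eps by case/andP: e01.
have B0 : 0 <= B by rewrite /B; case: ifP => _; rewrite mulr_ge0 ?powR_ge0 ?(ltW C0).
have main T' u' v' : weak_solution g K c p q R1 u0 u1 v0 v1 eps T' u' v' -> (T' <= B%:E)%E.
  move=> ws; rewrite leNgt; apply/negP => BT.
  have [T1 BT1 T1T] : exists2 T1 : R, B < T1 & (T1%:E < T')%E.
    case: T' BT {ws} => [r| |//].
      rewrite lte_fin => Br; exists ((B + r) / 2); first by rewrite midf_lt.
      by rewrite lte_fin midf_lt.
    by move=> _; exists (B + 1); [rewrite ltrDl|exact: ltry].
  have T10 : 0 < T1 by exact: le_lt_trans BT1.
  have [x [dx [y [dy [f ax ay]]]]] := fb eps T' u' v' T1 eps0 ws T10 T1T.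
  have := bound eps T1 x dx y dy e01 (ltW T10) ax ay f.
  by rewrite leNgt BT1.
have TB : (Teps <= B%:E)%E.
  apply: ge_ereal_sup => T' [_ [u' [v' [ws _]]]]; exact: main ws.
by split => //; apply: le_lt_trans TB (ltry _).
Qed.
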